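(* Let $\mathbb F$ be a field and let $q\in\mathbb F$ be nonzero and not a root of unity. Let $N\in\mathbb N$ and let $V$ be an irreducible $U_q(\mathfrak{sl}_2)$-module with dimension $N+1$. Then: (i) the following are totally opposite flags on $V$: $$\{\nu_x^{N-i}V\}_{i=0}^N,\qquad \{\nu_y^{N-i}V\}_{i=0}^N,\qquad \{\nu_z^{N-i}V\}_{i=0}^N;$$ (ii) for the corresponding Billiard Array on $V$, the value of each white 3-clique is $q^{-2}$.
   Context: $U_q(\mathfrak{sl}_2)$ denotes the associative $\mathbb F$-algebra (equitable presentation) with generators $x,y^{\pm1},z$ and relations $yy^{-1}=1$, $y^{-1}y=1$, $$\frac{qxy-q^{-1}yx}{q-q^{-1}}=1,\qquad \frac{qyz-q^{-1}zy}{q-q^{-1}}=1,\qquad \frac{qzx-q^{-1}xz}{q-q^{-1}}=1.$$ Its elements $\nu_x,\nu_y,\nu_z$ are $\nu_x=q(1-yz)=q^{-1}(1-zy)$, $\nu_y=q(1-zx)=q^{-1}(1-xz)$, $\nu_z=q(1-xy)=q^{-1}(1-yx)$. Here $\nu_x^kV$ is the image of $V$ under the action of $\nu_x^k$ (so $\nu_x^0V=V$), and similarly for $\nu_y,\nu_z$. A flag on $V$ ($\dim V=N+1$) is a sequence $\{U_i\}_{i=0}^N$ of subspaces of $V$ with $\dim U_i=i+1$ for $0\le i\le N$ and $U_{i-1}\subseteq U_i$ for $1\le i\le N$. Three flags $\{U_i\}_{i=0}^N,\{U'_i\}_{i=0}^N,\{U''_i\}_{i=0}^N$ on $V$ are called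 totally opposite whenever $U_{N-r}\cap U'_{N-s}\cap U''_{N-t}=0$ for all integers $r,s,t$ with $0\le r,s,t\le N$ and $r+s+t>N$. $\mathbb N=\{0,1,2,\ldots\}$. $\Delta_n=\{(r,s,t): r,s,t\in\mathbb N,\ r+s+t=n\}$, whose elements are called locations. A line in $\Delta_N$ is a set consisting of all locations whose $\eta$-coordinate equals a fixed number $m$, for some $\eta\in\{1,2,3\}$ and some $0\le m\le N$. Locations $\lambda,\mu$ are adjacent if $\lambda-\mu$ is one of $\pm(1,-1,0),\pm(0,1,-1),\pm(-1,0,1)$. For $N\ge1$, a black 3-clique in $\Delta_N$ is a set $\{(r+1,s,t),(r,s+1,t),(r,s,t+1)\}$ with $(r,s,t)\in\Delta_{N-1}$. Each pair of adjacent locations is contained in a unique black 3-clique. For $N\ge2$, a white 3-clique in $\Delta_N$ is a set $\{(r,s+1,t+1),(r+1,s,t+1),(r+1,s+1,t)\}$ with $(r,s,t)\in\Delta_{N-2}$; for $N\le1$ there are none. Let $\mathcal P_1(V)$ be the set of one-dimensional subspaces of $V$. A Billiard Array on $V$ is a function $B:\Delta_N\to\mathcal P_1(V)$, $\lambda\mapsto B_\lambda$, such that (a) for each line $L$ in $\Delta_N$ the sum $\sum_{\lambda\in L}B_\lambda$ is direct; (b) for each black 3-clique $C$ in $\Delta_N$ the sum $\sum_{\lambda\in C}B_\lambda$ is not direct. The Billiard Array corresponding to three totally opposite flags $\{U_i\},\{U'_i\},\{U''_i\}$ (in this order) is $B_{(r,s,t)}=U_{N-r}\cap U'_{N-s}\cap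 U''_{N-t}$ for $(r,s,t)\in\Delta_N$; it is indeed a Billiard Array. For adjacent $\lambda,\mu\in\Delta_N$, let $\nu$ be the unique location such that $\lambda,\mu,\nu$ form a black 3-clique. For each nonzero $u\in B_\lambda$ there is a unique nonzero $v\in B_\mu$ with $u+v\in B_\nu$; the $\mathbb F$-linear bijection $\tilde B_{\lambda,\mu}:B_\lambda\to B_\mu$ sends $u\mapsto v$. For a white 3-clique $\lambda=(r,s+1,t+1)$, $\mu=(r+1,s,t+1)$, $\nu=(r+1,s+1,t)$, the composition $\tilde B_{\nu,\lambda}\circ\tilde B_{\mu,\nu}\circ\tilde B_{\lambda,\mu}:B_\lambda\to B_\lambda$ is a nonzero scalar multiple of the identity; this scalar is the value ($B$-value) of the white 3-clique. *)

(* Defs.v *)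
From HB Require Import structures.
From mathcomp Require Import all_boot all_order all_algebra.
From mathcomp Require Import ring_quotient boolp classical_sets.
From mathcomp Require Import monalg zify.

Set Implicit Arguments.
Unset Strict Implicit.
Unset Printing Implicit Defensive.

Import GRing.Theory.
Local Open Scope ring_scope.
Local Open Scope set_scope.

(* MathComp only provides quotients of commutative rings by ideals. *)
Section QuotientAlgebra.
Variables (F : fieldType) (A : algType F) (rel : A -> Prop).

Inductive in_ideal : A -> Prop :=
| ideal_rel a : rel a -> in_ideal a
| ideal0 : in_ideal 0
| idealB a b : in_ideal a -> in_ideal b -> in_ideal (a - b)
| idealMl c a : in_ideal a -> in_ideal (c * a)
| idealMr c a : in_ideal a -> in_ideal (a * c).

Definition ideal_pred : pred A := fun a => `[< in_ideal a >].

Fact ideal_zmod_closed : zmod_closed ideal_pred.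
Proof.
split; first by apply/asboolP; exact: ideal0.
by move=> a b /asboolP Ia /asboolP Ib; apply/asboolP; exact: idealB.
Qed.

HB.instance Definition _ :=
  GRing.isZmodClosed.Build A ideal_pred ideal_zmod_closed.

Definition ideal_zmod : zmodClosed A := GRing.ZmodClosed.clone A ideal_pred _.

Definition quotAlg : Type := Quotient.quot ideal_zmod.

HB.instance Definition _ := GRing.Zmodule.on quotAlg.

Definition qa_pi : A -> quotAlg := locked (\pi_(Quotient.quot ideal_zmod))%qT.

Lemma qa_piP (u : quotAlg) : exists a, u = qa_pi a.
Proof. by exists (repr u); rewrite /qa_pi -lock reprK. Qed.

Lemma qa_pi_eq a b : qa_pi a = qa_pi b <-> in_ideal (a - b).
Proof.
rewrite /qa_pi -lock; split=> [/eqP|I]; last apply/eqP.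
  by rewrite -Quotient.idealrBE => /asboolP.
by rewrite -Quotient.idealrBE; apply/asboolP.
Qed.

Lemma qa_piD a b : qa_pi (a + b) = qa_pi a + qa_pi b.
Proof. by rewrite /qa_pi -lock; exact: Quotient.pi_add. Qed.

Definition qa_one : quotAlg := qa_pi 1.
Definition qa_mul : quotAlg -> quotAlg -> quotAlg :=
  locked (fun u v => qa_pi (repr u * repr v)).
Definition qa_scale : F -> quotAlg -> quotAlg := locked (fun c u => qa_pi (c *: repr u)).

Lemma qa_repr a : in_ideal (repr (qa_pi a) - a).
Proof. by apply/qa_pi_eq; rewrite /qa_pi -lock reprK. Qed.

Lemma idealD a b : in_ideal a -> in_ideal b -> in_ideal (a + b).
Proof.
move=> Ia Ib; rewrite -[b]opprK; apply: idealB => //; rewrite -[- b]add0r.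
by apply: idealB => //; exact: ideal0.
Qed.

Lemma qa_piM a b : qa_pi (a * b) = qa_mul (qa_pi a) (qa_pi b).
Proof.
rewrite /qa_mul -lock; apply/esym/qa_pi_eq; set a' := repr _; set b' := repr _.
have -> : a' * b' - a * b = (a' - a) * b' + a * (b' - b).
  by rewrite mulrBl mulrBr addrA subrK.
by apply: idealD; [apply: idealMr | apply: idealMl]; exact: qa_repr.
Qed.

Lemma qa_piZ c a : qa_pi (c *: a) = qa_scale c (qa_pi a).
Proof.
rewrite /qa_scale -lock; apply/esym/qa_pi_eq; rewrite -scalerBr -[repr _ - _]mul1r scalerAl.
by apply: idealMl; exact: qa_repr.
Qed.

Fact qa_mulA : associative qa_mul.
Proof.
move=> u v w; have [[a ->] [b ->] [c ->]] := And3 (qa_piP u) (qa_piP v) (qa_piP w).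
by rewrite -!qa_piM mulrA.
Qed.

Fact qa_mul1 : left_id qa_one qa_mul.
Proof. by move=> u; have [a ->] := qa_piP u; rewrite -qa_piM mul1r. Qed.

Fact qa_mulr1 : right_id qa_one qa_mul.
Proof. by move=> u; have [a ->] := qa_piP u; rewrite -qa_piM mulr1. Qed.

Fact qa_mulDl : left_distributive qa_mul +%R.
Proof.
move=> u v w; have [[a ->] [b ->] [c ->]] := And3 (qa_piP u) (qa_piP v) (qa_piP w).
by rewrite -qa_piD -!qa_piM -qa_piD mulrDl.
Qed.

Fact qa_mulDr : right_distributive qa_mul +%R.
Proof.
move=> u v w; have [[a ->] [b ->] [c ->]] := And3 (qa_piP u) (qa_piP v) (qa_piP w).
by rewrite -qa_piD -!qa_piM -qa_piD mulrDr.
Qed.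

HB.instance Definition _ := GRing.Zmodule_isPzRing.Build quotAlg
  qa_mulA qa_mul1 qa_mulr1 qa_mulDl qa_mulDr.

Fact qa_scaleA c d u : qa_scale c (qa_scale d u) = qa_scale (c * d) u.
Proof. by have [a ->] := qa_piP u; rewrite -!qa_piZ scalerA. Qed.

Fact qa_scale1 : left_id 1 qa_scale.
Proof. by move=> u; have [a ->] := qa_piP u; rewrite -qa_piZ scale1r. Qed.

Fact qa_scaleDr : right_distributive qa_scale +%R.
Proof.
move=> c u v; have [[a ->] [b ->]] := conj (qa_piP u) (qa_piP v).
by rewrite -qa_piD -!qa_piZ -qa_piD scalerDr.
Qed.

Fact qa_scaleDl u : {morph qa_scale^~ u : c d / c + d}.
Proof.
by move=> c d; have [a ->] := qa_piP u; rewrite -!qa_piZ -qa_piD scalerDl.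
Qed.

HB.instance Definition _ := GRing.Zmodule_isLmodule.Build F quotAlg
  qa_scaleA qa_scale1 qa_scaleDr qa_scaleDl.

Fact qa_pi_zmod_morphism : zmod_morphism qa_pi.
Proof.
move=> a b; rewrite qa_piD; congr (_ + _).
by rewrite /qa_pi -lock; exact: Quotient.pi_opp.
Qed.

Fact qa_pi_monoid_morphism : monoid_morphism qa_pi.
Proof. by split; [reflexivity | exact: qa_piM]. Qed.

Fact qa_pi_scalable : scalable qa_pi.
Proof. exact: qa_piZ. Qed.

HB.instance Definition _ := GRing.isZmodMorphism.Build A quotAlg qa_pi
  qa_pi_zmod_morphism.
HB.instance Definition _ := GRing.isMonoidMorphism.Build A quotAlg qa_pi
  qa_pi_monoid_morphism.
HB.instance Definition _ := GRing.isScalable.Build F A quotAlg *:%R qa_pi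
  qa_pi_scalable.

(* quotAlg is an associative F-algebra, but algType also requires 1 != 0 *)
Lemma qa_scalerAl (c : F) (u v : quotAlg) : c *: (u * v) = (c *: u) * v.
Proof.
have [[a ->] [b ->]] := conj (qa_piP u) (qa_piP v).
by rewrite -rmorphM -!linearZ -rmorphM scalerAl.
Qed.

Lemma qa_scalerAr (c : F) (u v : quotAlg) : c *: (u * v) = u * (c *: v).
Proof.
have [[a ->] [b ->]] := conj (qa_piP u) (qa_piP v).
by rewrite -rmorphM -!linearZ -rmorphM scalerAr.
Qed.

Lemma qa_pi_rel a b : rel (a - b) -> qa_pi a = qa_pi b.
Proof. by move=> r; apply/qa_pi_eq; exact: ideal_rel. Qed.

Fact qa_rel1M a b : rel (a * b - 1) -> qa_pi a * qa_pi b = 1.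
Proof. by move=> /qa_pi_rel; rewrite rmorphM rmorph1. Qed.

Fact qa_rel1E c d e a b : rel (c *: (d *: (a * b) - e *: (b * a)) - 1) ->
  c *: (d *: (qa_pi a * qa_pi b) - e *: (qa_pi b * qa_pi a)) = 1.
Proof.
by move=> /qa_pi_rel; rewrite linearZ linearB !linearZ /= !rmorphM rmorph1.
Qed.
End QuotientAlgebra.

(* F<x, y, y^-1, z>, with generators numbered in this order *)
Definition freeAlg (F : fieldType) : Type := {malg F[{fmonom 'I_4}]}.

HB.instance Definition _ (F : fieldType) := GRing.Lalgebra.on (freeAlg F).

Fact free_scalerAr (F : fieldType) (c : F) (a b : freeAlg F) :
  c *: (a * b) = a * (c *: b).
Proof.
have comm : a * c%:MP = c%:MP * a.
  rewrite [LHS]fgmulgU [RHS]fgmulUg; apply: eq_bigr => k _.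
  by rewrite mulm1 mul1m mulrC.
transitivity (c%:MP * (a * b)); first by rewrite mul_malgC.
transitivity (a * (c%:MP * b)); last by rewrite mul_malgC.
by rewrite [LHS]mulrA [RHS]mulrA comm.
Qed.

HB.instance Definition _ (F : fieldType) :=
  GRing.LSemiAlgebra_isSemiAlgebra.Build F (freeAlg F) (@free_scalerAr F).

Section Uq.
Variables (F : fieldType) (q : F).

Local Notation A := (freeAlg F).

Definition fgen (i : 'I_4) : A := mkmalgU (fmu i) 1.

Definition fx : A := fgen (@Ordinal 4 0 isT).
Definition fy : A := fgen (@Ordinal 4 1 isT).
Definition fyV : A := fgen (@Ordinal 4 2 isT).
Definition fz : A := fgen (@Ordinal 4 3 isT).

Inductive uq_relator : A -> Prop :=
| rel_yyV : uq_relator (fy * fyV - 1)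
| rel_yVy : uq_relator (fyV * fy - 1)
| rel_xy : uq_relator ((q - q^-1)^-1 *: (q *: (fx * fy) - q^-1 *: (fy * fx)) - 1)
| rel_yz : uq_relator ((q - q^-1)^-1 *: (q *: (fy * fz) - q^-1 *: (fz * fy)) - 1)
| rel_zx : uq_relator ((q - q^-1)^-1 *: (q *: (fz * fx) - q^-1 *: (fx * fz)) - 1).

Definition Uq : Type := quotAlg uq_relator.

HB.instance Definition _ := GRing.PzRing.on Uq.
HB.instance Definition _ := GRing.Lmodule.on Uq.

Definition uqx : Uq := qa_pi uq_relator fx.
Definition uqy : Uq := qa_pi uq_relator fy.
Definition uqyV : Uq := qa_pi uq_relator fyV.
Definition uqz : Uq := qa_pi uq_relator fz.

Definition nu_x : Uq := q *: (1 - uqy * uqz).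
Definition nu_y : Uq := q *: (1 - uqz * uqx).
Definition nu_z : Uq := q *: (1 - uqx * uqy).

Lemma uq_yyV : uqy * uqyV = 1.
Proof. exact: qa_rel1M rel_yyV. Qed.

Lemma uq_yVy : uqyV * uqy = 1.
Proof. exact: qa_rel1M rel_yVy. Qed.

Lemma uq_xy :
  (q - q^-1)^-1 *: (q *: (uqx * uqy) - q^-1 *: (uqy * uqx)) = 1.
Proof. exact: qa_rel1E rel_xy. Qed.

Lemma uq_yz :
  (q - q^-1)^-1 *: (q *: (uqy * uqz) - q^-1 *: (uqz * uqy)) = 1.
Proof. exact: qa_rel1E rel_yz. Qed.

Lemma uq_zx :
  (q - q^-1)^-1 *: (q *: (uqz * uqx) - q^-1 *: (uqx * uqz)) = 1.
Proof. exact: qa_rel1E rel_zx. Qed.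

End Uq.

Record uq_module (F : fieldType) (q : F) (V : vectType F) := UqModule {
  uq_act :> {linear Uq q -> 'End(V)};
  uq_act1 : uq_act 1 = \1%VF;
  uq_actM : forall a b, uq_act (a * b) = (uq_act a \o uq_act b)%VF
}.

Section Modules.
Variables (F : fieldType) (q : F) (V : vectType F) (rho : uq_module q V).

Definition uq_submodule (W : {vspace V}) : Prop :=
  forall a, (rho a @: W <= W)%VS.

Definition uq_irreducible : Prop :=
  fullv != 0%VS :> {vspace V} /\
  forall W : {vspace V}, uq_submodule W -> W = 0%VS \/ W = fullv.

(* the sequence {a^(N-i) V}_i *)
Definition power_images (a : Uq q) (N : nat) : nat -> {vspace V} :=
  fun i => (rho (a ^+ (N - i)) @: fullv)%VS.
End Modules.

(* only the terms U 0, ..., U N of a sequence U are used *)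
Section Flags.
Variables (F : fieldType) (V : vectType F) (N : nat).

Definition flag (U : nat -> {vspace V}) : Prop :=
  (forall i, i <= N -> \dim (U i) = i.+1)%N /\
  (forall i, 1 <= i <= N -> (U i.-1 <= U i)%VS)%N.

Definition totally_opposite (U U' U'' : nat -> {vspace V}) : Prop :=
  forall r s t, (r <= N)%N -> (s <= N)%N -> (t <= N)%N -> (N < r + s + t)%N ->
    (U (N - r)%N :&: U' (N - s)%N :&: U'' (N - t)%N)%VS = 0%VS.
End Flags.

Definition Delta (N : nat) :=
  {l : 'I_N.+1 * 'I_N.+1 * 'I_N.+1 | (l.1.1 + l.1.2 + l.2)%N == N}.

Definition location_val N (l : Delta N) : nat * nat * nat :=
  (val (val l).1.1, val (val l).1.2, val (val l).2).

Definition location_coord N (l : Delta N) (eta : 'I_3) : nat :=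
  let: (r, s, t) := location_val l in nth 0%N [:: r; s; t] eta.

Definition line N (L : {set Delta N}) : Prop :=
  exists eta m, (m <= N)%N /\ L = [set l | location_coord l eta == m].

Definition black_clique N (C : {set Delta N}) : Prop :=
  exists r s t, (r + s + t).+1 = N /\
    C = [set l | location_val l \in [:: (r.+1, s, t); (r, s.+1, t); (r, s, t.+1)]].

Definition white_clique N (l m n : Delta N) : Prop :=
  exists r s t, (r + s + t).+2 = N /\
    [/\ location_val l = (r, s.+1, t.+1), location_val m = (r.+1, s, t.+1) &
        location_val n = (r.+1, s.+1, t)].

Section BilliardArrays.
Variables (F : fieldType) (V : vectType F) (N : nat).
Implicit Types (B : Delta N -> {vspace V}) (l m n : Delta N).

Definition billiard_array B : Prop :=
  [/\ forall l, \dim (B l) = 1%N,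
      forall L : {set Delta N}, line L -> directv (\sum_(l in L) B l)%VS &
      forall C : {set Delta N}, black_clique C ->
        ~~ directv (\sum_(l in C) B l)%VS].

Definition flag_array (U U' U'' : nat -> {vspace V}) : Delta N -> {vspace V} :=
  fun l => let: (r, s, t) := location_val l in
    (U (N - r)%N :&: U' (N - s)%N :&: U'' (N - t)%N)%VS.

Definition is_btilde B l m (f : 'Hom(subvs_of (B l), subvs_of (B m))) : Prop :=
  forall u, u != 0 -> f u != 0 /\
    exists2 n, black_clique [set l; m; n] & vsval u + vsval (f u) \in B n.

(* for a Billiard Array B and adjacent l, m, exactly one map satisfies is_btilde,
   so the default 0 is not used; similarly for clique_value *)
Definition btilde B l m : 'Hom(subvs_of (B l), subvs_of (B m)) :=
  xget 0 (@is_btilde B l m).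

Definition clique_value B l m n : F :=
  xget 0 (fun c : F => forall u : subvs_of (B l),
    btilde B n l (btilde B m n (btilde B l m u)) = c *: u).
End BilliardArrays.

Section FlagArrays.
Variables (F : fieldType) (V : vectType F) (N : nat).
Hypothesis dimV : \dim {:V} = N.+1.
Implicit Types U : nat -> {vspace V}.

Lemma flag_dim U i : flag N U -> (i <= N)%N -> \dim (U i) = i.+1.
Proof. by move=> [dimU _]; exact: dimU. Qed.

Lemma flag_le U i j : flag N U -> (i <= j <= N)%N -> (U i <= U j)%VS.
Proof.
move=> flU /andP[lij]; rewrite -(subnK lij) addnC.
elim: (j - i)%N => [|k IH]; first by rewrite addn0.
rewrite addnS => lkN; apply: (subv_trans (IH (ltnW lkN))).
by case: flU => _ /(_ (i + k).+1); apply; rewrite lkN.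
Qed.

Lemma dim_cap_ge (A B : {vspace V}) : (\dim A + \dim B - N.+1 <= \dim (A :&: B))%N.
Proof.
have := dimv_sum_cap A B; have := dimvS (subvf (A + B)%VS); rewrite dimV; lia.
Qed.

Lemma dim_cap_ub (A B C : {vspace V}) :
  (A <= C)%VS -> (B <= C)%VS -> (\dim A + \dim B <= \dim (A :&: B) + \dim C)%N.
Proof.
move=> AC BC; rewrite addnC -[X in (_ <= X)%N]addnC.
have := dimv_sum_cap A B; have : (\dim (A + B) <= \dim C)%N.
  by apply: dimvS; rewrite subv_add AC.
lia.
Qed.

Section TotallyOpposite.
Variables U U' U'' : nat -> {vspace V}.
Hypotheses (flU : flag N U) (flU' : flag N U') (flU'' : flag N U'').
Hypothesis opp : totally_opposite N U U' U''.

Let W r s t := (U (N - r) :&: U' (N - s) :&: U'' (N - t))%VS.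

Lemma dim_cap3_le k r s t : (r <= N)%N -> (s <= N)%N -> (t <= N)%N ->
  (r + s + t + k = N.+1)%N -> (\dim (W r s t) <= k)%N.
Proof.
elim: k r => [|k IH] r rN sN tN E.
  by rewrite /W opp ?dimv0 //; lia.
have [rN'|rN'] := ltnP r N; last first.
  have -> : r = N by lia.
  apply: (@leq_trans (\dim (U 0%N))); last by rewrite (flag_dim flU).
  by rewrite /W subnn; apply/dimvS/(subv_trans (capvSl _ _))/capvSl.
have E' : (r.+1 + s + t + k = N.+1)%N by lia.
have := IH _ rN' sN tN E'.
have -> : W r.+1 s t = (W r s t :&: U (N - r.+1))%VS.
  rewrite /W -!capvA [RHS](_ : _ = (U (N - r) :&: U (N - r.+1)) :&: (U' (N - s) :&: U'' (N - t)))%VS.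
    congr (_ :&: _)%VS; apply/esym/capv_idPr/flag_le => //; lia.
  by rewrite -!capvA; congr (_ :&: _)%VS; rewrite capvA capvC.
have := @dim_cap_ub (W r s t) (U (N - r.+1)) (U (N - r)).
rewrite !(flag_dim flU) ?leq_subr //.
have -> : (W r s t <= U (N - r))%VS by rewrite /W -capvA capvSl.
have -> : (U (N - r.+1) <= U (N - r))%VS by apply: flag_le => //; lia.
move=> /(_ isT isT); lia.
Qed.

Lemma dim_cap3_ge r s t : (r <= N)%N -> (s <= N)%N -> (t <= N)%N ->
  (N.+1 - (r + s + t) <= \dim (W r s t))%N.
Proof.
move=> rN sN tN; have := dim_cap_ge (U (N - r)) (U' (N - s)).
have := dim_cap_ge (U (N - r) :&: U' (N - s))%VS (U'' (N - t)); rewrite -/(W r s t).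
rewrite (flag_dim flU) ?(flag_dim flU') ?(flag_dim flU'') ?leq_subr //; lia.
Qed.

Lemma line_direct (c d e : Delta N -> nat) (B : Delta N -> {vspace V}) m :
    (forall l, c l + d l + e l = N)%N ->
    (forall l l', c l = c l' -> d l = d l' -> l = l') ->
    (forall l, B l = W (c l) (d l) (e l)) ->
  directv (\sum_(l in [set l | c l == m]) B l)%VS.
Proof.
move=> sumN inj BW; apply/directv_sum_independent => us usB sum0.
suff H k l : l \in [set l | c l == m] -> (d l < k)%N -> us l = 0.
  by move=> l lL; apply: (H (d l).+1).
elim: k l => // k IH l lL dk.
have small i : i \in [set l | c l == m] -> (d i < d l)%N -> us i = 0.
  by move=> iL il; apply: IH => //; lia.
have neq i : i \in [set l | c l == m] -> i != l -> d i <> d l.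
  move: lL; rewrite !inE => /eqP cl /eqP ci il di.
  by move: il; rewrite (inj i l) ?eqxx ?ci ?cl.
have usl : us l = - \sum_(i in [set l | c l == m] | i != l) us i.
  by apply/eqP; rewrite -addr_eq0 -(bigD1 l lL) /= sum0.
have [dN|dN] := ltnP (d l) N; last first.
  rewrite usl big1 ?oppr0 // => i /andP[iL il]; apply: small => //.
  by have := sumN i; have := neq i iL il; lia.
have usU : us l \in U' (N - (d l).+1)%N.
  rewrite usl memvN; apply: memv_suml => i /andP[iL il].
  have [lt|lt] := ltnP (d i) (d l); first by rewrite small ?mem0v.
  have := usB i iL; rewrite BW /W !memv_cap => /andP[/andP[_ +] _].
  by apply: (subvP (flag_le flU' _)); have := neq i iL il; lia.
have := usB l lL; rewrite BW /W !memv_cap => /andP[/andP[h1 _] h3].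
have sl := sumN l; apply/eqP; rewrite -memv0.
rewrite -(opp (r := c l) (s := (d l).+1) (t := e l)) ?memv_cap ?h1 ?usU //; lia.
Qed.
End TotallyOpposite.

Lemma location_inj l l' : location_val l = location_val l' -> l = l' :> Delta N.
Proof.
move: l l' => [[[r s] t] E] [[[r' s'] t'] E']; rewrite /location_val /=.
by case=> /val_inj rr /val_inj ss /val_inj tt; apply: val_inj; rewrite /= rr ss tt.
Qed.

Lemma location_sum (l : Delta N) :
  (let: (r, s, t) := location_val l in (r + s + t)%N = N).
Proof. by move: l => [[[r s] t] E]; exact/eqP. Qed.

Lemma location_ex r s t : (r + s + t = N)%N ->
  exists l : Delta N, location_val l = (r, s, t).
Proof.
move=> E; have rN : (r < N.+1)%N by lia.
have sN : (s < N.+1)%N by lia.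
have tN : (t < N.+1)%N by lia.
pose l := (Ordinal rN, Ordinal sN, Ordinal tN).
have H : (l.1.1 + l.1.2 + l.2)%N == N by exact/eqP.
by exists (exist (fun l : 'I_N.+1 * 'I_N.+1 * 'I_N.+1 => is_true ((l.1.1 + l.1.2 + l.2)%N == N)) l H).
Qed.

Lemma card_black_clique (C : {set Delta N}) : black_clique C -> #|C| = 3%N.
Proof.
move=> [r [s [t [E ->]]]].
have [a Ea] : exists l : Delta N, location_val l = (r.+1, s, t) by apply: location_ex; lia.
have [b Eb] : exists l : Delta N, location_val l = (r, s.+1, t) by apply: location_ex; lia.
have [c Ec] : exists l : Delta N, location_val l = (r, s, t.+1) by apply: location_ex; lia.
have ab : a != b by apply/eqP => ab; move: Ea; rewrite ab Eb => -[]; lia.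
have ac : a != c by apply/eqP => ac; move: Ea; rewrite ac Ec => -[]; lia.
have bc : b != c by apply/eqP => bc; move: Eb; rewrite bc Ec => -[]; lia.
set D := [set l | _].
have -> : D = [set:: [:: a; b; c]].
  apply/setP => l; rewrite !inE -Ea -Eb -Ec.
  by congr [|| _, _ | _]; apply/eqP/eqP => [/location_inj|->].
by rewrite cardsE (card_uniqP _) //= !inE negb_or ab ac bc.
Qed.

Lemma flag_array_billiard U U' U'' :
    flag N U -> flag N U' -> flag N U'' -> totally_opposite N U U' U'' ->
  billiard_array (flag_array (N := N) U U' U'').
Proof.
move=> flU flU' flU'' opp.
have dim_flag_array (l : Delta N) : \dim (flag_array U U' U'' l) = 1%N.
  rewrite /flag_array; move: (location_sum l).
  case: (location_val l) => [[r s] t] E.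
  apply/eqP; rewrite eqn_leq (dim_cap3_le flU opp) /=; try lia.
  by apply: leq_trans (dim_cap3_ge flU flU' flU'' _ _ _); lia.
split.
- exact: dim_flag_array.
- move=> _ [eta [m [_ ->]]].
  pose x (l : Delta N) := (location_val l).1.1.
  pose y (l : Delta N) := (location_val l).1.2.
  pose z (l : Delta N) := (location_val l).2.
  have xyz l : (x l + y l + z l = N)%N.
    by move: (location_sum l); rewrite /x /y /z; case: (location_val l) => [[]].
  have eqP3 l l' : x l = x l' -> y l = y l' -> z l = z l' -> l = l'.
    rewrite /x /y /z => h1 h2 h3; apply: location_inj; move: h1 h2 h3.
    by case: (location_val l) (location_val l') => [[? ?] ?] [[? ?] ?] /= -> -> ->.
  have BE l : flag_array U U' U'' l =
      (U (N - x l)%N :&: U' (N - y l)%N :&: U'' (N - z l)%N)%VS.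
    by rewrite /flag_array /x /y /z; case: (location_val l) => [[]].
  have cE l : location_coord l eta = nth 0%N [:: x l; y l; z l] eta.
    by rewrite /location_coord /x /y /z; case: (location_val l) => [[]].
  have -> : [set l | location_coord l eta == m] = [set l | nth 0%N [:: x l; y l; z l] eta == m].
    by apply/setP => l; rewrite !inE cE.
  case: eta {cE} => [[|[|[|//]]] ?] /=.
  + apply: (line_direct flU' opp (d := y) (e := z)) => //.
    by move=> l l' h1 h2; apply: eqP3 => //; have := xyz l; have := xyz l'; lia.
  + apply: (line_direct (U := U') (U'' := U) flU'' _ (d := z) (e := x)).
    * move=> r s t rN sN tN rst; rewrite -(opp t r s) //; last lia.
      by rewrite [LHS]capvC capvA.
    * by move=> l; have := xyz l; lia.
    * by move=> l l' h1 h2; apply: eqP3 => //; have := xyz l; have := xyz l'; lia.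
    * by move=> l; rewrite BE -capvA capvC.
  + apply: (line_direct (U := U'') (U'' := U') flU _ (d := x) (e := y)).
    * move=> r s t rN sN tN rst; rewrite -(opp s t r) //; last lia.
      by rewrite -capvA [LHS]capvC.
    * by move=> l; have := xyz l; lia.
    * by move=> l l' h1 h2; apply: eqP3 => //; have := xyz l; have := xyz l'; lia.
    * by move=> l; rewrite BE -[RHS]capvA [RHS]capvC.
- move=> C bC; apply/negP => /directvP /=.
  have -> : (\sum_(l in C) \dim (flag_array U U' U'' l) = 3)%N.
    rewrite (eq_bigr (fun=> 1%N)) ?sum1_card ?card_black_clique //.
  case: bC => r [s [t [E ->]]] dim3.
  have : (\dim (U (N - r)%N :&: U' (N - s)%N :&: U'' (N - t)%N)%VS <= 2)%N.
    by apply: (dim_cap3_le flU opp); lia.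
  suff /dimvS : (\sum_(l in [set l : Delta N | location_val l \in
      [:: (r.+1, s, t); (r, s.+1, t); (r, s, t.+1)]]) flag_array U U' U'' l <=
      U (N - r)%N :&: U' (N - s)%N :&: U'' (N - t)%N)%VS.
    by rewrite dim3 => h1 h2; have := leq_trans h1 h2.
  apply/subv_sumP => l; rewrite /flag_array !inE.
  by case/or3P => /eqP ->; do 2?[apply: capvS]; apply: flag_le => //; lia.
Qed.
End FlagArrays.

(* Main.v *)
Require Import Defs.
From HB Require Import structures.
From mathcomp Require Import all_boot all_order all_algebra.
From mathcomp Require Import boolp monalg ring zify.
From mathcomp Require classical_sets.

Set Implicit Arguments.
Unset Strict Implicit.
Unset Printing Implicit Defensive.

Import GRing.Theory VectorInternalTheory.
Local Open Scope ring_scope.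

(** Write X, Y, Z for the operators on V given by x, y, z, and nx, ny, nz for
those given by nu_x = q(1 - yz), nu_y = q(1 - zx), nu_z = q(1 - xy).  The
defining relations are invariant under the rotation x -> y -> z -> x, so that
it is enough to analyse one of the generators, say Y, and to rotate.

The structure of V.  The relations give nx Y = q^2 Y nx and
nz Y = q^-2 Y nz.  As Y is injective and q is not a root of unity, nx and nz
are nilpotent ([qcomm_nilpotent]).  The exchange rule [nu_exchange], the
analogue of the commutation of E and F, then shows that the kernel of nx
contains an eigenvector of Y even though the field need not be algebraically
closed ([lowering_eigenvector]).  The chain v_i = nz^i v of such a vector v
spans a subspace stable under X, Y, Z; by irreducibility it is a basis of V
([chain_basis]).  On it Y is diagonal with eigenvalues theta q^(2i), nz raises
and nx lowers the index, and Z is bidiagonal.  As the chain stops after v_N,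
theta^2 q^(2N) = 1 ([theta_sqr]).  In these coordinates the images of the
powers of nx and of nz are coordinate subspaces, which gives all the facts about the
triple (X, Y, Z) collected in [ladder].  In particular Z is injective,
so that the same applies to (Y, Z, X), and then to (Z, X, Y).

The three flags.  Combining the ladders of two rotations, each of the three
operators acts in the same way with respect to the three flags
([flag_action]): with e_i = theta q^(2i), the operator Z satisfies
  (Z - e_r) nx^r V <= nx^(r+1) V,   (Z - e_(N-s)) ny^s V <= ny^(s+1) V,
  Z nz^(t+1) V <= nz^t V,
and it has no eigenvector in nz V.  Put
S(r,s,t) = nx^r V :&: ny^s V :&: nz^t V.  Total oppositeness, that is
S(r,s,t) = 0 for r + s + t > N, follows by induction on t: Z - e_r maps
S(r,s,t+1) into S(r+1,s,t) = 0, so that S(r,s,t+1) consists of eigenvectors of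
Z in nz V ([flag_action_opposite]).

The values.  For a white 3-clique let u be in S(r,s+1,t+1), v in S(r+1,s,t+1)
and w in S(r+1,s+1,t), where v and w are the successive images of u, and let k u
be the image of w.  The three operators act on these vectors by
  Z u = e_r u + a w,          Z v = e_(N-s) v - a w,
  X v = e_s v + b u,          X w = e_(N-t) w - b u,
  Y w = e_t w + c v,          Y (k u) = e_(N-r) (k u) - c v
for some scalars a, b, c ([flag_action_edge]), which are nonzero since Z has no
eigenvector in nz V and likewise for X and Y.  The relation between Z and X
applied to v gives a = q^2 e_r - e_(N-s), the relation between Y and Z applied to k u
gives k a = e_r - q^-2 e_(N-s), and hence k = q^-2
([white_clique_scalar]). *)

(** * Linear identities between vectors *)

Section VectorCoord.
Variables (F : fieldType) (V : vectType F).
Implicit Types (u v : V) (f : 'End(V)).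

(** Coordinates in an arbitrary basis turn an identity between linear
combinations of vectors into an identity between scalars, which the ring and
field tactics decide. *)
Definition vcoord i u : F := v2r u 0 i.

Lemma vcoord_inj u v : (forall i, vcoord i u = vcoord i v) -> u = v.
Proof. by move=> uv; apply: v2r_inj; apply/rowP. Qed.

Lemma vcoordD i u v : vcoord i (u + v) = vcoord i u + vcoord i v.
Proof. by rewrite /vcoord linearD mxE. Qed.

Lemma vcoordN i u : vcoord i (- u) = - vcoord i u.
Proof. by rewrite /vcoord linearN mxE. Qed.

Lemma vcoordZ i a u : vcoord i (a *: u) = a * vcoord i u.
Proof. by rewrite /vcoord linearZ mxE. Qed.

Lemma vcoord0 i : vcoord i 0 = 0.
Proof. by rewrite /vcoord linear0 mxE. Qed.

Lemma lfunD f u v : f (u + v) = f u + f v.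
Proof. exact: linearD. Qed.

Lemma lfunN f u : f (- u) = - f u.
Proof. exact: linearN. Qed.

Lemma lfunZ f a u : f (a *: u) = a *: f u.
Proof. exact: linearZ. Qed.

End VectorCoord.

Definition vector_simp :=
  (lfunD, lfunN, lfunZ, vcoordD, vcoordN, vcoordZ, vcoord0).

Ltac vector_ring := apply: vcoord_inj => ?; rewrite ?vector_simp; ring.
Ltac vector_field := apply: vcoord_inj => ?; rewrite ?vector_simp; field.

(** * Iterates of an endomorphism and their images *)

Lemma expr_not1_inj (F : fieldType) (c : F) :
    c != 0 -> (forall k, (0 < k)%N -> c ^+ k != 1) ->
  injective (fun k : nat => c ^+ k).
Proof.
move=> c0 c1; suff H i j : (i < j)%N -> c ^+ i != c ^+ j.
  by move=> i j; case: (ltngtP i j) => // /H /eqP // + E; rewrite E.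
move=> ij; rewrite -(subnKC (ltnW ij)) exprD -{1}[c ^+ i]mulr1.
by rewrite (inj_eq (mulfI (expf_neq0 _ c0))) eq_sym c1 // subn_gt0.
Qed.

Section Iterates.
Variables (F : fieldType) (V : vectType F).
Implicit Types (f Y : 'End(V)) (u v w : V) (W : {vspace V}).

Definition iter_lfun k f : 'End(V) := iter k (comp_lfun f) \1%VF.

Lemma iter_lfunE k f u : iter_lfun k f u = iter k f u.
Proof.
by elim: k => [|k IH]; rewrite /iter_lfun /= ?id_lfunE // comp_lfunE IH.
Qed.

Lemma iter0v f k : iter k f 0 = 0.
Proof. by rewrite -iter_lfunE linear0. Qed.

Lemma iter_qcomm f Y c u k : (forall u, f (Y u) = c *: Y (f u)) ->
  iter k f (Y u) = c ^+ k *: Y (iter k f u).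
Proof.
move=> fY; elim: k => [|k /= ->]; first by rewrite expr0 scale1r.
by rewrite linearZ /= fY scalerA exprS mulrC.
Qed.

(** Shortening of a dependency: substituting Y u for u multiplies the coefficient
of f^i by c^i, and subtracting c^k times the original dependency kills the
leading coefficient without killing any other nonzero one.  A dependency with
a single nonzero coefficient says that a power of f vanishes. *)
Lemma dependent_iter_nilpotent f Y c k (a : nat -> F) :
    c != 0 -> (forall i, (0 < i)%N -> c ^+ i != 1) ->
    (forall u, f (Y u) = c *: Y (f u)) -> (forall u, Y u = 0 -> u = 0) ->
    (forall u, \sum_(i < k) a i *: iter i f u = 0) ->
    (exists2 i, (i < k)%N & a i != 0) ->
  exists m, forall u, iter m f u = 0.
Proof.
move=> c0 c1 fY injY; elim: k a => [|k IH] a dep [i ik ai] //.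
have [/existsP[j aj]|/existsPn a0] := boolP [exists j : 'I_k, a j != 0]; last first.
  exists k => u; have := dep u; rewrite big_ord_recr /= big1 => [|j _]; last first.
    by have := a0 j; rewrite negbK => /eqP ->; rewrite scale0r.
  have -> : k = i.
    move: ik; rewrite ltnS leq_eqVlt => /orP[/eqP //|ik].
    by have := a0 (Ordinal ik); rewrite /= ai.
  by rewrite add0r => /eqP; rewrite scaler_eq0 (negPf ai) => /eqP.
apply: (IH (fun i => a i * (c ^+ i - c ^+ k))); last first.
  exists j => //; rewrite mulf_neq0 // subr_eq0.
  by apply/eqP => /(expr_not1_inj c0 c1); have := ltn_ord j; lia.
move=> u; have depc : \sum_(i < k.+1) (a i * c ^+ i) *: iter i f u = 0.
  apply: injY; rewrite -[RHS](dep (Y u)) linear_sum; apply: eq_bigr => l _.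
  by rewrite linearZ /= (iter_qcomm _ _ fY) scalerA.
transitivity (\sum_(i < k.+1) (a i * (c ^+ i - c ^+ k)) *: iter i f u).
  by rewrite big_ord_recr /= subrr mulr0 scale0r addr0.
transitivity (\sum_(i < k.+1) (a i * c ^+ i) *: iter i f u -
    c ^+ k *: \sum_(i < k.+1) a i *: iter i f u).
  rewrite scaler_sumr -sumrB; apply: eq_bigr => l _.
  by rewrite scalerA -scalerBl mulrBr [c ^+ k * _]mulrC.
by rewrite depc dep scaler0 subr0.
Qed.

(** An operator that is similar to a multiple of itself by a scalar of infinite
order is nilpotent.  No eigenvalues are available, but in finite dimension the
powers of f are linearly dependent. *)
Lemma qcomm_nilpotent f Y c :
    c != 0 -> (forall i, (0 < i)%N -> c ^+ i != 1) ->
    (forall u, f (Y u) = c *: Y (f u)) -> (forall u, Y u = 0 -> u = 0) ->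
  exists m, forall u, iter m f u = 0.
Proof.
move=> c0 c1 fY injY.
pose d := (\dim {:'End(V)}).+1.
have : ~~ free [tuple iter_lfun i f | i < d].
  apply/negP; rewrite /free size_tuple => /eqP dimd.
  by have := dimvS (subvf <<[tuple iter_lfun i f | i < d]>>); rewrite dimd ltnn.
move=> /negP nfree; apply: contrapT => notnil; apply: nfree.
apply/freeP => k dep i; case: (eqVneq (k i) 0) => // ki; case: notnil.
apply: (@dependent_iter_nilpotent f Y c d (fun j => oapp k 0 (insub j))) => // [u|].
  transitivity ((\sum_(j < d) k j *: [tuple iter_lfun i f | i < d]`_j) u); last first.
    by rewrite dep zero_lfunE.
  rewrite sum_lfunE; apply: eq_bigr => j _.
  by rewrite scale_lfunE -tnth_nth tnth_mktuple iter_lfunE valK.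
by exists i => //; rewrite valK.
Qed.

Lemma nilpotent_chain f u m : u != 0 -> iter m f u = 0 ->
  exists2 d, iter d f u != 0 & iter d.+1 f u = 0.
Proof.
move=> u0; elim: m => [|m IH] fm; first by move: u0; rewrite [u]fm eqxx.
by have [/IH //|fm0] := eqVneq (iter m f u) 0; exists m.
Qed.

(** Applying f^(d-i) to a dependency isolates its lowest nonzero coefficient. *)
Lemma chain_free f u d : iter d f u != 0 -> iter d.+1 f u = 0 ->
  free [tuple iter i f u | i < d.+1].
Proof.
move=> fd0 fd1; apply/freeP => k dep i.
have {}dep : \sum_(l < d.+1) k l *: iter l f u = 0.
  by rewrite -{}[RHS]dep; apply: eq_bigr => l _; rewrite -tnth_nth tnth_mktuple.
have iter0 j : (d < j)%N -> iter j f u = 0.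
  by move=> dj; rewrite -(subnK dj) iterD fd1 iter0v.
suff H n (j : 'I_d.+1) : (j < n)%N -> k j = 0 by apply: (H i.+1).
elim: n j => // n IH j jn.
have := congr1 (iter_lfun (d - j) f) dep; rewrite linear0.
rewrite linear_sum (bigD1 j) //= big1 => [|l lj]; last first.
  have [{}lj|jl] := ltnP l j.
    by rewrite (IH l (leq_trans lj jn)) scale0r linear0.
  rewrite linearZ /= iter_lfunE -iterD iter0 ?scaler0 //.
  have : (l : nat) != j by [].
  have := ltn_ord j; lia.
rewrite addr0 linearZ /= iter_lfunE -iterD subnK ?leq_ord // => /eqP.
by rewrite scaler_eq0 (negPf fd0) orbF => /eqP.
Qed.

Lemma span_stable f n (v : nat -> V) :
    (forall i, (i < n)%N -> f (v i) \in <<[tuple v i | i < n]>>%VS) ->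
  (f @: <<[tuple v i | i < n]>> <= <<[tuple v i | i < n]>>)%VS.
Proof.
move=> fv; rewrite limg_span; apply/span_subvP => _ /mapP[_ /tnthP[i ->] ->].
by rewrite tnth_mktuple fv.
Qed.

Definition power_image f r : {vspace V} := (iter_lfun r f @: fullv)%VS.

Lemma power_imageP f r u :
  reflect (exists w, u = iter r f w) (u \in power_image f r).
Proof.
apply: (iffP memv_imgP) => [[w _ ->]|[w ->]]; exists w; rewrite ?memvf //;
by rewrite iter_lfunE.
Qed.

Lemma power_imageS f r : (power_image f r.+1 <= power_image f r)%VS.
Proof.
apply/subvP => _ /power_imageP[w ->]; apply/power_imageP; exists (f w).
by rewrite -iterSr.
Qed.

Lemma power_image_le f i j : (i <= j)%N -> (power_image f j <= power_image f i)%VS.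
Proof.
move=> /subnK <-; elim: (j - i)%N => [|k IH] //.
by rewrite addSn (subv_trans (power_imageS f _)).
Qed.

Lemma power_image_flag N f :
  (forall t, \dim (power_image f t) = (N.+1 - t)%N) ->
  flag N (fun i => power_image f (N - i)).
Proof.
move=> dimf; split=> [i iN|i /andP[i0 iN]]; first by rewrite dimf; lia.
by apply: power_image_le; lia.
Qed.

Lemma line_scalar (W : {vspace V}) u w :
  \dim W = 1%N -> u != 0 -> u \in W -> w \in W -> exists a, w = a *: u.
Proof.
move=> dimW u0 uW wW; apply/vlineP; suff -> : <[u]>%VS = W by [].
by apply/eqP; rewrite eqEdim -memvE uW dim_vline u0 dimW.
Qed.

End Iterates.

(** * The equitable relations *)

Section Operators.
Variables (F : fieldType) (q : F) (V : vectType F).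
Implicit Types (A B X Y Z f : 'End(V)) (u v w : V) (W : {vspace V}).

(** The equitable relation between two consecutive generators, cleared of the
denominator q - q^-1. *)
Definition qcommute A B :=
  forall u, q *: A (B u) - q^-1 *: B (A u) = (q - q^-1) *: u.

(** With (A, B) = (Y, Z), (Z, X), (X, Y) this is the action of nu_x, nu_y,
nu_z. *)
Definition nu A B : 'End(V) := q *: (\1 - (A \o B))%VF.

(** Stated for the three operators alone, so as to be invariant under
rotation. *)
Definition irreducible_triple X Y Z := forall W, (X @: W <= W)%VS ->
  (Y @: W <= W)%VS -> (Z @: W <= W)%VS -> W = 0%VS \/ W = fullv.

Lemma irreducible_triple_rot X Y Z :
  irreducible_triple X Y Z -> irreducible_triple Y Z X.
Proof. by move=> irr W WY WZ WX; apply: irr. Qed.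

Hypothesis q_neq0 : q != 0.

Lemma nuE A B u : nu A B u = q *: (u - A (B u)).
Proof. by rewrite /nu !(scale_lfunE, add_lfunE, opp_lfunE, id_lfunE, comp_lfunE). Qed.

Lemma qcommuteE A B u : qcommute A B ->
  A (B u) = (1 - q ^- 2) *: u + q ^- 2 *: B (A u).
Proof.
move=> /(_ u)/(canRL (subrK _)) AB; apply: (scalerI q_neq0).
by rewrite AB; vector_field.
Qed.

Lemma nuE_rev A B u : qcommute A B -> nu A B u = q^-1 *: (u - B (A u)).
Proof. by move=> AB; rewrite nuE (qcommuteE _ AB); vector_field. Qed.

(** The two expressions of nu A B, by AB and by BA, are used on the two sides;
likewise for B below. *)
Lemma nu_commutel A B u : qcommute A B -> nu A B (A u) = q ^+ 2 *: A (nu A B u).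
Proof. by move=> AB; rewrite nuE nuE_rev //; vector_field. Qed.

Lemma nu_commuter A B u : qcommute A B -> nu A B (B u) = q ^- 2 *: B (nu A B u).
Proof. by move=> AB; rewrite nuE_rev // nuE; vector_field. Qed.

Section Raising.
Variables X Y Z : 'End(V).
Hypotheses (XY : qcommute X Y) (YZ : qcommute Y Z) (ZX : qcommute Z X).
Local Notation nx := (nu Y Z).
Local Notation nz := (nu X Y).

(** Expanding nx nz with nx = q(1 - YZ), nz = q(1 - XY), and nz nx with
nz = q^-1(1 - YX), nx = q^-1(1 - ZY), the terms of degree four of q^-1 nx nz
and q nz nx differ by Y (q ZX - q^-1 XZ) Y, which is (q - q^-1) Y^2 by the
relation between Z and X. *)
Lemma nu_exchange u :
  nx (nz u) = q ^+ 2 *: nz (nx u) - (q ^+ 2 - 1) *: (u - Y (Y u)).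
Proof.
rewrite [nz (nx u)]nuE_rev // [nx u]nuE_rev // [nx _]nuE [nz u]nuE.
rewrite !(lfunD, lfunN, lfunZ).
(* Modulo these three instances of the relations both sides are the same
   combination of words. *)
rewrite (qcommuteE (Y u) ZX) (qcommuteE u XY) (qcommuteE u YZ) !(lfunD, lfunZ);
by vector_field.
Qed.

Lemma nu_exchange_iter k u : nx (iter k.+1 nz u) =
  (q ^+ 2) ^+ k.+1 *: iter k.+1 nz (nx u) -
  ((q ^+ 2) ^+ k.+1 - 1) *:
    (iter k nz u - (q ^+ 2) ^+ k *: iter k nz (Y (Y u))).
Proof.
have nzYY j : Y (Y (iter j nz u)) = ((q ^+ 2) ^+ j) ^+ 2 *: iter j nz (Y (Y u)).
  rewrite !(iter_qcomm _ _ (fun u => nu_commuter u XY)) !linearZ /= !scalerA.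
  by rewrite exprVn -expr2 exprVn mulVf ?scale1r ?expf_neq0.
elim: k => [|k IH].
  by rewrite nu_exchange /= expr0 expr1; vector_field.
rewrite iterS nu_exchange IH nzYY !iterS; move: (q ^+ 2) => c.
rewrite (exprS c k.+1) !(exprS c k); move: (c ^+ k) => d.
by vector_field.
Qed.

End Raising.

Hypothesis q_not1 : forall k, (0 < k)%N -> q ^+ k != 1.

Lemma sqr_not1 k : (0 < k)%N -> (q ^+ 2) ^+ k != 1.
Proof. by move=> k0; rewrite -exprM q_not1 // muln_gt0. Qed.

Lemma sqrV_not1 k : (0 < k)%N -> (q ^- 2) ^+ k != 1.
Proof. by move=> k0; rewrite exprVn invr_eq1 sqr_not1. Qed.

(** * The chain generated by an eigenvector *)

Section Ladder.
Variables X Y Z : 'End(V).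
Hypotheses (XY : qcommute X Y) (YZ : qcommute Y Z) (ZX : qcommute Z X).
Hypothesis injY : forall u, Y u = 0 -> u = 0.
Local Notation nx := (nu Y Z).
Local Notation nz := (nu X Y).

Let c0 : q ^+ 2 != 0. Proof. exact: expf_neq0. Qed.

(** On the kernel of nx the exchange rule says that nx nz^(s+1) v is a nonzero
multiple of nz^s (1 - q^(2s) Y^2) v.  So as long as (1 - q^(2s) Y^2) v is
nonzero, it is a vector of the kernel killed by a smaller power of nz; this
cannot go on, and when it stops v is an eigenvector of Y^2 with a square
eigenvalue. *)
Lemma lowering_eigenvector_sqr s v : v != 0 -> nx v = 0 -> iter s nz v = 0 ->
  exists k, exists w, [/\ w != 0, nx w = 0 & Y (Y w) = (q ^- k) ^+ 2 *: w].
Proof.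
elim: s v => [|s IH] v v0 xv zv; first by move: v0; rewrite [v]zv eqxx.
have nxY u : nx u = 0 -> nx (Y u) = 0.
  by move=> xu; rewrite nu_commutel // xu linear0 scaler0.
have [w0|w0] := eqVneq (v - (q ^+ 2) ^+ s *: Y (Y v)) 0.
  exists s, v; split => //; move/eqP: w0; rewrite subr_eq0 => /eqP {2}->.
  by rewrite scalerA exprVn exprAC mulVf ?scale1r ?expf_neq0.
apply: (IH _ w0); first by rewrite linearB linearZ /= xv !nxY // scaler0 subr0.
have := nu_exchange_iter XY YZ ZX s v.
rewrite zv xv iter0v linear0 scaler0 sub0r => /esym/eqP.
rewrite oppr_eq0 scaler_eq0 subr_eq0 (negPf (sqr_not1 _)) //= => /eqP E.
by rewrite -iter_lfunE linearB linearZ /= !iter_lfunE.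
Qed.

(** A vector w of the kernel of nx with Y^2 w = mu^2 w is itself an eigenvector
of Y for the eigenvalue -mu, or else Y w + mu w is one for the eigenvalue
mu. *)
Lemma lowering_eigenvector : fullv != 0%VS :> {vspace V} ->
  exists theta v, [/\ v != 0, nx v = 0 & Y v = theta *: v].
Proof.
rewrite -vpick0 => u0.
have [m nil_x] := qcomm_nilpotent c0 sqr_not1 (fun u => nu_commutel u YZ) injY.
have [d xd xd1] := nilpotent_chain u0 (nil_x _).
have [s nil_z] :=
  qcomm_nilpotent (invr_neq0 c0) sqrV_not1 (fun u => nu_commuter u XY) injY.
have [k [w [w0 xw yyw]]] := lowering_eigenvector_sqr xd xd1 (nil_z _).
have [yw|yw] := eqVneq (Y w + q ^- k *: w) 0.
  exists (- q ^- k), w; split => //.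
  by apply/eqP; rewrite scaleNr -addr_eq0 yw.
exists (q ^- k), (Y w + q ^- k *: w); split => //.
  by rewrite linearD linearZ /= nu_commutel // xw linear0 !scaler0 addr0.
by rewrite linearD linearZ /= yyw scalerDr scalerA expr2 addrC.
Qed.

Section Chain.
Variables (theta : F) (v : V).
Hypotheses (v0 : v != 0) (nxv : nx v = 0) (Yv : Y v = theta *: v).
Local Notation c := (q ^+ 2).
Local Notation v_ i := (iter i nz v).

Lemma theta_neq0 : theta != 0.
Proof.
by apply: contraNneq v0 => t0; apply/eqP/injY; rewrite Yv t0 scale0r.
Qed.

Lemma chain_Y i : Y (v_ i) = (theta * c ^+ i) *: v_ i.
Proof.
apply: (scalerI (expf_neq0 i (invr_neq0 c0))).
rewrite -(iter_qcomm v i (fun u => nu_commuter u XY)) Yv -iter_lfunE linearZ /=.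
rewrite iter_lfunE scalerA exprVn mulrCA mulVf ?mulr1 //; exact: expf_neq0.
Qed.

Lemma chain_nx i :
  nx (v_ i.+1) = - ((c ^+ i.+1 - 1) * (1 - c ^+ i * theta ^+ 2)) *: v_ i.
Proof.
rewrite (nu_exchange_iter XY YZ ZX) nxv iter0v scaler0 sub0r.
have -> : iter i nz (Y (Y v)) = theta ^+ 2 *: v_ i.
  by rewrite -!iter_lfunE Yv !linearZ /= Yv linearZ /= scalerA.
by move: (iter i nz v) (c ^+ i.+1) (c ^+ i) => w a b; vector_field.
Qed.

Lemma chain_Z0 : Z v = theta^-1 *: v.
Proof.
apply: (scalerI theta_neq0); rewrite scalerA mulfV ?theta_neq0 // scale1r.
have := nuE_rev v YZ; rewrite nxv Yv linearZ => /esym/eqP.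
by rewrite scaler_eq0 invr_eq0 (negPf q_neq0) subr_eq0 => /eqP <-.
Qed.

(** This is nx = q^-1(1 - ZY) read on an eigenvector of Y. *)
Lemma chain_Z i : Z (v_ i.+1) = (theta * c ^+ i.+1)^-1 *:
  (v_ i.+1 + (q * (c ^+ i.+1 - 1) * (1 - c ^+ i * theta ^+ 2)) *: v_ i).
Proof.
have t0 : theta * c ^+ i.+1 != 0 by rewrite mulf_neq0 ?theta_neq0 ?expf_neq0.
apply: (scalerI t0); rewrite scalerA mulfV // scale1r.
have := nuE_rev (v_ i.+1) YZ; rewrite chain_nx chain_Y linearZ /=.
move=> /(congr1 ( *:%R q)); rewrite [RHS]scalerA mulfV // scale1r.
move=> /eqP; rewrite eq_sym subr_eq addrC -subr_eq => /eqP <-.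
by rewrite scalerA mulrN scaleNr opprK mulrA.
Qed.

(** This is nz = q(1 - XY) read on an eigenvector of Y. *)
Lemma chain_X i : X (v_ i) = (theta * c ^+ i)^-1 *: (v_ i - q^-1 *: v_ i.+1).
Proof.
have t0 : theta * c ^+ i != 0 by rewrite mulf_neq0 ?theta_neq0 ?expf_neq0.
apply: (scalerI t0); rewrite scalerA mulfV // scale1r /=.
by rewrite -linearZ /= -chain_Y nuE scalerA mulVf // scale1r opprB addrC subrK.
Qed.

Variable N : nat.
Hypotheses (dimV : \dim {:V} = N.+1)
  (irr : irreducible_triple X Y Z).

(** The span of the nonzero v_i is stable under X, Y and Z, so that it is all of
V; its dimension shows that the chain has exactly N + 1 nonzero terms. *)
Lemma chain_basis : basis_of fullv [tuple v_ i | i < N.+1] /\ v_ N.+1 = 0.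
Proof.
have [s nil_z] :=
  qcomm_nilpotent (invr_neq0 c0) sqrV_not1 (fun u => nu_commuter u XY) injY.
have [d vd vd1] := nilpotent_chain v0 (nil_z v).
have freev := chain_free vd vd1.
set W := (<<[tuple v_ i | i < d.+1]>>)%VS.
have memW i : (i <= d.+1)%N -> v_ i \in W.
  rewrite leq_eqVlt => /orP[/eqP ->|id]; first by rewrite vd1 mem0v.
  apply: memv_span; apply/tnthP; exists (Ordinal id); by rewrite tnth_mktuple.
have Wfull : W = fullv.
  have [|||W0|//] := irr (W := W).
  - apply: span_stable => i id.
    by rewrite chain_X memvZ // memvB ?memvZ ?memW // ltnW.
  - by apply: span_stable => i id; rewrite chain_Y memvZ // memW // ltnW.
  - apply: span_stable => -[|i] id; first by rewrite chain_Z0 memvZ ?(memW 0%N).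
    by rewrite chain_Z memvZ // memvD ?memvZ ?memW // ltnW // ltnW.
  by have := memW 0%N isT; rewrite W0 memv0 (negPf v0).
have dN : d = N.
  by apply: succn_inj; rewrite -dimV -Wfull (eqnP freev) size_tuple.
move: freev Wfull vd1; rewrite /W dN => freev Wfull vN; split => //.
by rewrite /basis_of freev Wfull eqxx.
Qed.

(** Since v_(N+1) = 0, the coefficient of v_N in nx v_(N+1) has to vanish. *)
Lemma theta_sqr : theta ^+ 2 * c ^+ N = 1.
Proof.
have [bas vN] := chain_basis.
have vN0 : v_ N != 0.
  apply: (free_not0 (basis_free bas)); apply/tnthP; exists ord_max.
  by rewrite tnth_mktuple.
have := chain_nx N; rewrite vN linear0 => /esym/eqP.
rewrite scaler_eq0 (negPf vN0) orbF oppr_eq0 mulf_eq0 !subr_eq0.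
by rewrite (negPf (sqr_not1 _)) // mulrC => /eqP <-.
Qed.

Local Notation b := [tuple v_ i | i < N.+1].

(** Indexing the coordinates by natural numbers, with value 0 beyond N, makes the
formulas for nx and Z uniform at the end of the chain. *)
Definition chain_coord j u : F := oapp (fun i => coord b i u) 0 (insub j).
Local Notation phi := chain_coord.

Lemma chain_coord_linear j a u w : phi j (a *: u + w) = a * phi j u + phi j w.
Proof.
by rewrite /phi; case: insubP => [i _ _|_] /=; rewrite ?linearP // mulr0 addr0.
Qed.

Lemma chain_coord0 j : phi j 0 = 0.
Proof. by have := chain_coord_linear j (-1) 0 0; rewrite scaler0 addr0 mulN1r addNr.
Qed.

Lemma chain_coordD j u w : phi j (u + w) = phi j u + phi j w.
Proof. by rewrite -[u]scale1r chain_coord_linear mul1r scale1r. Qed.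

Lemma chain_coordZ j a u : phi j (a *: u) = a * phi j u.
Proof. by rewrite -[a *: u]addr0 chain_coord_linear chain_coord0 addr0. Qed.

Lemma chain_coord_sum (a : nat -> V) k j :
  phi j (\sum_(i < k) a i) = \sum_(i < k) phi j (a i).
Proof.
by elim: k => [|k IH]; rewrite ?big_ord0 ?chain_coord0 // !big_ord_recr chain_coordD IH.
Qed.

Lemma chain_coord_gt j u : (N < j)%N -> phi j u = 0.
Proof. by move=> Nj; rewrite /phi insubF //; apply/negbTE; rewrite -leqNgt. Qed.

Lemma chain_coord_chain i j : (i <= N)%N -> phi j (v_ i) = (i == j)%:R.
Proof.
move=> iN; have [bas _] := chain_basis; rewrite /phi.
have E : v_ i = b`_(Ordinal (iN : (i < N.+1)%N)) by rewrite -tnth_nth tnth_mktuple.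
case: insubP => [k _ <-|jN] /=.
  by rewrite E coord_free ?(basis_free bas).
by case: eqP => // ij; rewrite -ij ltnS iN in jN.
Qed.

Lemma chain_coord_decomp u : u = \sum_(i < N.+1) phi i u *: v_ i.
Proof.
have [bas _] := chain_basis; rewrite [LHS](coord_basis bas (memvf u)).
by apply: eq_bigr => i _; rewrite -tnth_nth tnth_mktuple /phi valK.
Qed.

Lemma chain_coord_eq0 u : (forall j, (j <= N)%N -> phi j u = 0) -> u = 0.
Proof.
move=> u0; rewrite [u]chain_coord_decomp big1 // => i _.
by rewrite u0 ?scale0r // -ltnS ltn_ord.
Qed.

Lemma chain_coord_ext (g h : V -> F) :
    (forall a u w, g (a *: u + w) = a * g u + g w) ->
    (forall a u w, h (a *: u + w) = a * h u + h w) ->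
    (forall i, (i <= N)%N -> g (v_ i) = h (v_ i)) ->
  g =1 h.
Proof.
move=> gl hl gh u; rewrite [u]chain_coord_decomp.
have [g0 h0] : g 0 = 0 /\ h 0 = 0.
  split; [have := gl (-1) 0 0 | have := hl (-1) 0 0];
  by rewrite scaler0 addr0 mulN1r addNr.
apply: (big_ind (fun s => g s = h s)) => [|w1 w2 gh1 gh2|i _].
- by rewrite g0.
- by rewrite -[w1]scale1r gl hl gh1 gh2.
- by rewrite -[_ *: _]addr0 gl hl g0 h0 gh // -ltnS ltn_ord.
Qed.

Lemma chain_coord_coef (a : nat -> F) j : (j <= N)%N ->
  phi j (\sum_(i < N.+1) a i *: v_ i) = a j.
Proof.
move=> jN; rewrite (chain_coord_sum (fun i => a i *: v_ i)).
rewrite (bigD1 (Ordinal (jN : (j < N.+1)%N))) //= big1 => [|i ij].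
  by rewrite chain_coordZ chain_coord_chain // eqxx mulr1 addr0.
move: ij; rewrite -val_eqE /= chain_coordZ chain_coord_chain ?leq_ord //.
by move/negPf ->; rewrite mulr0.
Qed.

Lemma chain_coord_Y j u : phi j (Y u) = theta * c ^+ j * phi j u.
Proof.
move: u; apply: chain_coord_ext => [a u w|a u w|i iN].
- by rewrite linearP chain_coord_linear.
- by rewrite chain_coord_linear; ring.
rewrite chain_Y chain_coordZ chain_coord_chain //.
by case: eqP => [->|]; rewrite ?mulr1 ?mulr0.
Qed.

Lemma chain_coord_nx j u : phi j (nx u) =
  - ((c ^+ j.+1 - 1) * (1 - c ^+ j * theta ^+ 2)) * phi j.+1 u.
Proof.
move: u; apply: chain_coord_ext => [a u w|a u w|i iN].
- by rewrite linearP chain_coord_linear.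
- by rewrite chain_coord_linear; ring.
case: i iN => [_|i iN].
  by rewrite /= nxv chain_coord0 (@chain_coord_chain 0) // mulr0.
rewrite chain_nx chain_coordZ !chain_coord_chain //; last exact: ltnW.
by rewrite eqSS; case: eqP => [->|]; rewrite ?mulr1 ?mulr0.
Qed.

Lemma chain_coord_nz0 u : phi 0 (nz u) = 0.
Proof.
move: u; apply: chain_coord_ext => [a u w|a u w|i iN].
- by rewrite linearP chain_coord_linear.
- by rewrite mulr0 addr0.
rewrite -iterS; move: iN; rewrite leq_eqVlt => /orP[/eqP ->|iN].
  by have [_ ->] := chain_basis; rewrite chain_coord0.
by rewrite chain_coord_chain.
Qed.

Lemma chain_coord_nzS j u : (j < N)%N -> phi j.+1 (nz u) = phi j u.
Proof.
move=> jN; move: u; apply: chain_coord_ext => [a u w|a u w|i iN].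
- by rewrite linearP chain_coord_linear.
- by rewrite chain_coord_linear.
rewrite chain_coord_chain // -iterS; move: iN; rewrite leq_eqVlt => /orP[/eqP ->|iN].
  by have [_ ->] := chain_basis; rewrite chain_coord0; case: eqP jN => // ->;
     rewrite ltnn.
by rewrite chain_coord_chain // eqSS.
Qed.

Local Notation lowering_coef j :=
  ((theta * c ^+ j.+1)^-1 * (q * (c ^+ j.+1 - 1) * (1 - c ^+ j * theta ^+ 2))).

Lemma chain_coord_Z j u :
  phi j (Z u) = (theta * c ^+ j)^-1 * phi j u + lowering_coef j * phi j.+1 u.
Proof.
move: u; apply: chain_coord_ext => [a u w|a u w|i iN].
- by rewrite linearP chain_coord_linear.
- by rewrite !chain_coord_linear; ring.
case: i iN => [_|i iN].
  rewrite /= chain_Z0 chain_coordZ !(@chain_coord_chain 0) //.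
  by case: j => [|j] /=; rewrite ?expr0 ?mulr1 ?mulr0 addr0.
rewrite chain_Z chain_coordZ chain_coordD chain_coordZ.
rewrite !chain_coord_chain //; last exact: ltnW.
rewrite eqSS mulrDr; congr (_ + _).
  by case: (eqVneq i.+1 j) => [->|_]; rewrite ?mulr0.
by case: (eqVneq i j) => [->|_]; rewrite ?mulr1 ?mulr0.
Qed.

Lemma ctheta_neq1 j : (j < N)%N -> 1 - c ^+ j * theta ^+ 2 != 0.
Proof.
move=> jN; rewrite subr_eq0 -theta_sqr mulrC.
have t0 : theta ^+ 2 != 0 by rewrite expf_neq0 ?theta_neq0.
apply/eqP => /(mulIf t0) /(expr_not1_inj c0 sqr_not1) E.
by rewrite -E ltnn in jN.
Qed.

Lemma lowering_coef_neq0 j : (j < N)%N -> lowering_coef j != 0.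
Proof.
move=> jN; rewrite !mulf_neq0 ?invr_eq0 ?mulf_neq0 ?theta_neq0 ?expf_neq0 //.
  by rewrite subr_eq0 sqr_not1.
exact: ctheta_neq1.
Qed.

Lemma inv_theta j : (j <= N)%N -> (theta * c ^+ j)^-1 = theta * c ^+ (N - j).
Proof.
move=> jN; have t0 : theta * c ^+ j != 0 by rewrite mulf_neq0 ?theta_neq0 ?expf_neq0.
apply: (mulfI t0); rewrite mulfV // mulrACA -expr2 -exprD subnKC //.
by rewrite theta_sqr.
Qed.

(** The operator nx is a weighted shift whose weights are nonzero below N, so that
a preimage is found by shifting the coordinates back. *)
Lemma mem_lowering_image r u :
  u \in power_image nx r <-> forall j, (N < j + r)%N -> phi j u = 0.
Proof.
split=> [/power_imageP[w ->]|].
  elim: r => [|r IH] j jr; first by rewrite chain_coord_gt // -[j]addn0.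
  by rewrite iterS chain_coord_nx IH ?mulr0 // addSnnS.
elim: r u => [|r IH] u u0; first by apply/power_imageP; exists u.
pose k j := - ((c ^+ j.+1 - 1) * (1 - c ^+ j * theta ^+ 2)).
pose w := \sum_(i < N.+1) (if i : nat is j.+1 then phi j u / k j else 0) *: v_ i.
have wE j : (j <= N)%N -> phi j w = if j is i.+1 then phi i u / k i else 0.
  move=> jN.
  by rewrite (chain_coord_coef (fun i => if i is l.+1 then phi l u / k l else 0)).
have nxw : u = nx w.
  apply/eqP; rewrite -subr_eq0; apply/eqP/chain_coord_eq0 => j.
  rewrite addrC -scaleN1r chain_coord_linear chain_coord_nx leq_eqVlt.
  move=> /orP[/eqP ->|jN].
    by rewrite chain_coord_gt // u0 ?mulr0 ?addr0 // addnS ltnS leq_addr.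
  rewrite wE // mulN1r -/(k j) mulrCA mulfV ?mulr1 ?addNr //.
  by rewrite oppr_eq0 mulf_neq0 ?ctheta_neq1 // subr_eq0 sqr_not1.
have /IH/power_imageP[w' w'E] : forall j, (N < j + r)%N -> phi j w = 0.
  move=> j jr; have [jN|/chain_coord_gt //] := leqP j N.
  rewrite wE //; case: j jN jr => // j jN jr.
  by rewrite u0 ?mul0r // addnS.
by apply/power_imageP; exists w'; rewrite nxw w'E.
Qed.

Lemma mem_raising_image t u :
  u \in power_image nz t <-> forall j, (j < t)%N -> phi j u = 0.
Proof.
split=> [/power_imageP[w ->]|].
  elim: t => [|t IH] // [|j] jt; first exact: chain_coord_nz0.
  have [jN|jN] := ltnP j N; last by rewrite chain_coord_gt.
  by rewrite iterS chain_coord_nzS ?IH.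
elim: t u => [|t IH] u u0; first by apply/power_imageP; exists u.
pose w := \sum_(i < N.+1) phi i.+1 u *: v_ i.
have wE j : (j <= N)%N -> phi j w = phi j.+1 u.
  by move=> jN; rewrite (chain_coord_coef (fun i => phi i.+1 u)).
have nzw : u = nz w.
  apply/eqP; rewrite -subr_eq0; apply/eqP/chain_coord_eq0 => j.
  rewrite addrC -scaleN1r chain_coord_linear mulN1r; case: j => [|j] jN.
    by rewrite chain_coord_nz0 u0 // oppr0 addr0.
  by rewrite chain_coord_nzS // wE ?addNr // ltnW.
have /IH/power_imageP[w' w'E] : forall j, (j < t)%N -> phi j w = 0.
  move=> j jt; have [jN|/chain_coord_gt //] := leqP j N.
  by rewrite wE // u0.
by apply/power_imageP; exists w'; rewrite nzw w'E.
Qed.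

Lemma dim_raising_image t : \dim (power_image nz t) = (N.+1 - t)%N.
Proof.
have [bas _] := chain_basis.
have -> : power_image nz t = <<drop t b>>%VS.
  apply/eqP; rewrite eqEsubv; apply/andP; split; apply/subvP => u.
    move/mem_raising_image => u0; rewrite [u]chain_coord_decomp.
    apply: memv_suml => i _.
    have [it|ti] := ltnP i t; first by rewrite u0 // scale0r mem0v.
    apply: memvZ; apply: memv_span; have -> : v_ i = nth 0 (drop t b) (i - t).
      by rewrite nth_drop subnKC // -tnth_nth tnth_mktuple.
    by rewrite mem_nth // size_drop size_tuple ltn_sub2r // (leq_ltn_trans ti).
  apply: subvP u; apply/span_subvP => _ /(nthP 0)[i + <-].
  rewrite size_drop size_tuple nth_drop => it.
  have tiN : (t + i < N.+1)%N by lia.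
  have -> : b`_(t + i) = v_ (t + i).
    rewrite -[RHS](tnth_mktuple (fun i : 'I_N.+1 => v_ i) (Ordinal tiN)).
    by rewrite (tnth_nth 0).
  by apply/power_imageP; exists (v_ i); rewrite -iterD.
have := basis_free bas; rewrite -{1}(cat_take_drop t b) => /catr_free /eqP ->.
by rewrite size_drop size_tuple.
Qed.

Lemma Y_raising_image t u : u \in power_image nz t ->
  Y u - (theta * c ^+ t) *: u \in power_image nz t.+1.
Proof.
move=> /mem_raising_image u0; apply/mem_raising_image => j.
rewrite addrC -scaleNr chain_coord_linear chain_coord_Y ltnS leq_eqVlt.
move=> /orP[/eqP ->|jt].
  by rewrite mulNr addNr.
by rewrite u0 // !mulr0 addr0.
Qed.

Lemma Y_lowering_image s u : (s <= N)%N -> u \in power_image nx s ->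
  Y u - (theta * c ^+ (N - s)) *: u \in power_image nx s.+1.
Proof.
move=> sN /mem_lowering_image u0; apply/mem_lowering_image => j.
rewrite addrC -scaleNr chain_coord_linear chain_coord_Y addnS ltnS leq_eqVlt.
move=> /orP[/eqP E|js].
  by rewrite {1}E addnK mulNr addNr.
by rewrite u0 // !mulr0 addr0.
Qed.

Lemma Z_raising_image t u : u \in power_image nz t.+1 -> Z u \in power_image nz t.
Proof.
move=> /mem_raising_image u0; apply/mem_raising_image => j jt.
by rewrite chain_coord_Z !u0 ?ltnS // ?mulr0 ?addr0 // ltnW.
Qed.

(** Comparing the coordinates of Z u and a u determines each coordinate of u from
the preceding one, and the first one is 0. *)
Lemma Z_raising_eigenvector a u : Z u = a *: u -> u \in power_image nz 1 -> u = 0.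
Proof.
move=> Zu /mem_raising_image u0; apply: chain_coord_eq0.
elim=> [|j IH] jN; first exact: u0.
have := chain_coord_Z j u; rewrite Zu chain_coordZ IH ?mulr0 ?add0r; last exact: ltnW.
by move/esym/eqP; rewrite mulf_eq0 (negPf (lowering_coef_neq0 jN)) => /eqP.
Qed.

Lemma raising_lowering_disjoint r s u : (N < r + s)%N ->
  u \in power_image nz r -> u \in power_image nx s -> u = 0.
Proof.
move=> rs /mem_raising_image u0 /mem_lowering_image u1; apply: chain_coord_eq0 => j jN.
by have [/u0 //|rj] := ltnP j r; apply: u1; apply: leq_trans rs _; rewrite leq_add2r.
Qed.

Lemma Z_lowest u : u \in power_image nx N -> Z u = (theta * c ^+ N) *: u.
Proof.
move=> /mem_lowering_image u0; apply/eqP; rewrite -subr_eq0; apply/eqP.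
apply: chain_coord_eq0 => j jN; rewrite addrC -scaleNr chain_coord_linear chain_coord_Z.
rewrite [phi j.+1 u]u0 ?mulr0 ?addr0; last by rewrite addSn ltnS leq_addl.
rewrite inv_theta //; case: j jN => [|j] jN; first by rewrite subn0 mulNr addNr.
by rewrite u0 ?mulr0 ?addr0 // addSn ltnS leq_addl.
Qed.

(** In the chain basis Z is triangular with nonzero diagonal entries. *)
Lemma Z_injective u : Z u = 0 -> u = 0.
Proof.
move=> Zu; suff H n j : (N < j + n)%N -> phi j u = 0.
  by apply: chain_coord_eq0 => j jN; apply: (H N.+1); rewrite addnS ltnS leq_addl.
elim: n j => [|n IH] j jn; first by rewrite chain_coord_gt // -[j]addn0.
have [jN|/chain_coord_gt //] := leqP j N; have := chain_coord_Z j u.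
rewrite Zu chain_coord0 [phi j.+1 u]IH ?mulr0 ?addr0; last by rewrite addSnnS.
by move/esym/eqP; rewrite mulf_eq0 invr_eq0 mulf_eq0 (negPf theta_neq0)
  (negPf (expf_neq0 _ c0)) => /eqP.
Qed.

End Chain.

End Ladder.

(** What the chain says about the triple (X, Y, Z), freed from the choice of the
chain.  The last two fields serve to pass to the rotated triple (Y, Z, X):
injectivity of Z is needed for its ladder to exist, and the action of Z on the
line nx^N V to see that it has the same theta. *)
Record ladder N theta (X Y Z : 'End(V)) : Prop := Ladder {
  ladder_theta : theta ^+ 2 * (q ^+ 2) ^+ N = 1;
  ladder_dim t : \dim (power_image (nu X Y) t) = (N.+1 - t)%N;
  ladder_raising t u : u \in power_image (nu X Y) t ->
    Y u - (theta * (q ^+ 2) ^+ t) *: u \in power_image (nu X Y) t.+1;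
  ladder_lowering s u : (s <= N)%N -> u \in power_image (nu Y Z) s ->
    Y u - (theta * (q ^+ 2) ^+ (N - s)) *: u \in power_image (nu Y Z) s.+1;
  ladder_shift t u : u \in power_image (nu X Y) t.+1 -> Z u \in power_image (nu X Y) t;
  ladder_no_eigenvector a u : Z u = a *: u -> u \in power_image (nu X Y) 1 -> u = 0;
  ladder_disjoint r s u : (N < r + s)%N -> u \in power_image (nu X Y) r ->
    u \in power_image (nu Y Z) s -> u = 0;
  ladder_lowest u : u \in power_image (nu Y Z) N -> Z u = (theta * (q ^+ 2) ^+ N) *: u;
  ladder_injective u : Z u = 0 -> u = 0
}.

Lemma ladder_exists N X Y Z : \dim {:V} = N.+1 -> irreducible_triple X Y Z ->
    qcommute X Y -> qcommute Y Z -> qcommute Z X -> (forall u, Y u = 0 -> u = 0) ->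
  exists theta, ladder N theta X Y Z.
Proof.
move=> dimV irr XY YZ ZX injY.
have V0 : fullv != 0%VS :> {vspace V} by rewrite -dimv_eq0 dimV.
have [theta [v [v0 nxv Yv]]] := lowering_eigenvector XY YZ ZX injY V0.
exists theta; split.
- exact: theta_sqr v0 nxv Yv N dimV irr.
- exact: dim_raising_image v0 nxv Yv N dimV irr.
- exact: Y_raising_image v0 nxv Yv N dimV irr.
- exact: Y_lowering_image v0 nxv Yv N dimV irr.
- exact: Z_raising_image v0 nxv Yv N dimV irr.
- exact: Z_raising_eigenvector v0 nxv Yv N dimV irr.
- exact: raising_lowering_disjoint v0 nxv Yv N dimV irr.
- exact: Z_lowest v0 nxv Yv N dimV irr.
- exact: Z_injective v0 nxv Yv N dimV irr.
Qed.

(** * Three flags and three operators *)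

(** How one generator acts on the three flags.  For Z the images of f, g, h are
those of nx, ny, nz; the other two generators have the same property with the
flags rotated, which is why the flags are parameters here. *)
Record flag_action N theta (f g h Z : 'End(V)) : Prop := FlagAction {
  action_fst r u : u \in power_image f r ->
    Z u - (theta * (q ^+ 2) ^+ r) *: u \in power_image f r.+1;
  action_snd s u : (s <= N)%N -> u \in power_image g s ->
    Z u - (theta * (q ^+ 2) ^+ (N - s)) *: u \in power_image g s.+1;
  action_shift t u : u \in power_image h t.+1 -> Z u \in power_image h t;
  action_no_eigenvector a u : Z u = a *: u -> u \in power_image h 1 -> u = 0;
  action_disjoint r s u : (N < r + s)%N -> u \in power_image f r ->
    u \in power_image g s -> u = 0
}.

(** Both ladders describe the action of Z on the line nx^N V, by theta q^(2N)
and theta' q^(2N) respectively. *)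
Lemma flag_action_of_ladders N theta theta' X Y Z :
    ladder N theta X Y Z -> ladder N theta' Y Z X ->
  theta' = theta /\ flag_action N theta (nu Y Z) (nu Z X) (nu X Y) Z.
Proof.
move=> L L'; suff E : theta' = theta.
  split=> //; split.
  - by rewrite -E; exact: ladder_raising L'.
  - by rewrite -E; exact: ladder_lowering L'.
  - exact: ladder_shift L.
  - exact: ladder_no_eigenvector L.
  - exact: ladder_disjoint L'.
have : power_image (nu Y Z) N != 0%VS.
  by rewrite -dimv_eq0 (ladder_dim L') subSnn.
rewrite -vpick0 => u0; have uN := memv_pick (power_image (nu Y Z) N).
have /eqP := ladder_dim L' N.+1; rewrite subnn dimv_eq0 => /eqP im0.
have := ladder_raising L' uN; rewrite im0 memv0 (ladder_lowest L uN).
rewrite -scalerBl scaler_eq0 (negPf u0) orbF -mulrBl mulf_eq0.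
by rewrite (negPf (expf_neq0 _ (expf_neq0 _ q_neq0))) orbF subr_eq0 => /eqP.
Qed.

Section FlagAction.
Variables (N : nat) (theta : F) (f g h Z : 'End(V)).
Hypothesis T : flag_action N theta f g h Z.
Local Notation e i := (theta * (q ^+ 2) ^+ i).
Local Notation inS r s t u :=
  [/\ u \in power_image f r, u \in power_image g s & u \in power_image h t].

Lemma flag_action_fst_stable r u : u \in power_image f r -> Z u \in power_image f r.
Proof.
move=> uf; rewrite -[Z u](subrK (e r *: u)) memvD ?memvZ //.
by apply: (subvP (power_imageS f r)); apply: action_fst T _ _ _.
Qed.

Lemma flag_action_snd_stable s u :
  (s <= N)%N -> u \in power_image g s -> Z u \in power_image g s.
Proof.
move=> sN ug; rewrite -[Z u](subrK (e (N - s) *: u)) memvD ?memvZ //.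
by apply: (subvP (power_imageS g s)); apply: action_snd T _ _ _ _.
Qed.

(** Induction on t.  By the induction hypothesis Z - e_r kills the intersection, so
that its elements are eigenvectors of Z in the image of h. *)
Lemma flag_action_opposite r s t u : (N < r + s + t)%N -> inS r s t u -> u = 0.
Proof.
elim: t r u => [|t IH] r u rst [uf ug uh].
  by apply: (action_disjoint T _ uf ug); rewrite -[(r + s)%N]addn0.
have [Ns|sN] := ltnP N s.
  by apply: (action_disjoint T _ uf ug); rewrite (leq_trans Ns) ?leq_addl.
apply: (action_no_eigenvector T (a := e r)); last first.
  exact: (subvP (power_image_le h (ltn0Sn t))).
apply/eqP; rewrite -subr_eq0; apply/eqP/(IH r.+1); first by rewrite !addSn -addnS.
split; first exact: action_fst T _ _ uf.
  by rewrite memvB ?memvZ // flag_action_snd_stable.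
by rewrite memvB ?memvZ ?(action_shift T) // (subvP (power_imageS h t)).
Qed.

(** The vectors u, v, u + v lie on the three lines of a black 3-clique.  The sum of
(Z - e_r) u and (Z - e_(N-s)) v lies in f^(r+1) V and g^(s+1) V, and also in
h^(t+1) V, because it differs from (Z - e_(N-s)) (u + v) by a multiple of u.
It vanishes by total oppositeness. *)
Lemma flag_action_edge r s t u v : (r + s + t).+2 = N ->
    inS r s.+1 t.+1 u -> inS r.+1 s t.+1 v -> u + v \in power_image h t.+2 ->
  let w := Z u - e r *: u in inS r.+1 s.+1 t w /\ Z v = e (N - s) *: v - w.
Proof.
move=> rst [uf ug uh] [vf vg vh] uvh w.
have sN : (s.+1 <= N)%N by lia.
have wS : inS r.+1 s.+1 t w.
  split; first exact: action_fst T _ _ uf.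
    by rewrite memvB ?memvZ // flag_action_snd_stable.
  by rewrite memvB ?memvZ ?(action_shift T) // (subvP (power_imageS h t)).
split => //; apply/eqP; rewrite eq_sym subr_eq -subr_eq0.
apply/eqP/(@flag_action_opposite r.+1 s.+1 t.+1); first lia.
have [wf wg wh] := wS.
(* This form of the vector places it in the images of g and h; the one below
   places it in the image of f. *)
have -> : e (N - s) *: v - (Z v + w) = - (Z (u + v) - e (N - s) *: (u + v) -
    (e r - e (N - s)) *: u) by rewrite /w; vector_field.
rewrite !memvN; split.
- have -> : Z (u + v) - e (N - s) *: (u + v) - (e r - e (N - s)) *: u =
      w + (Z v - e (N - s) *: v) by rewrite /w; vector_field.
  by rewrite memvD // memvB ?memvZ // flag_action_fst_stable.
- rewrite memvB ?memvZ //; apply: (action_snd T); first exact: ltnW.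
  by rewrite memvD // (subvP (power_imageS g s)).
- by rewrite !memvB ?memvZ ?(action_shift T) // (subvP (power_imageS h t.+1)).
Qed.

(** Two of the three lines of a black 3-clique are the images of the third one
under Z - e_(N-s) and Z - e_r, whose difference is a scalar. *)
Lemma flag_action_split r s t p : (r + s + t).+2 = N -> p != 0 -> inS r s t.+2 p ->
  exists u v, [/\ u != 0, v != 0, inS r s.+1 t.+1 u, inS r.+1 s t.+1 v &
    u + v \in power_image h t.+2].
Proof.
move=> rst p0 [pf pg ph].
have sN : (s <= N)%N by lia.
have nz a : Z p - a *: p != 0.
  apply: contraNneq p0 => /eqP; rewrite subr_eq0 => /eqP Zp; apply/eqP.
  by apply: (action_no_eigenvector T Zp); apply: subvP ph; exact: power_image_le.
exists (Z p - e (N - s) *: p), (- (Z p - e r *: p)); split; rewrite ?oppr_eq0 //.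
- split; [|exact: action_snd T _ _ _ _|].
    by rewrite memvB ?memvZ // flag_action_fst_stable.
  by rewrite memvB ?memvZ ?(action_shift T) // (subvP (power_imageS h _)).
- rewrite !memvN; split; [exact: action_fst T _ _ _| |].
    by rewrite memvB ?memvZ // flag_action_snd_stable.
  by rewrite memvB ?memvZ ?(action_shift T) // (subvP (power_imageS h _)).
- have -> : Z p - e (N - s) *: p - (Z p - e r *: p) = (e r - e (N - s)) *: p.
    by vector_ring.
  exact: memvZ.
Qed.

End FlagAction.

(** Only two relations are needed: the coefficient of u in the relation between Z
and X at v, and the coefficient of v in the relation between Y and Z at k u.
They give a = q^2 a1 - a2 and k a = a1 - q^-2 a2. *)
Lemma white_clique_scalar X Y Z u v w (k a1 a2 b1 b2 g1 g2 a b c : F) :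
    qcommute Y Z -> qcommute Z X ->
    (forall x y, x *: u + y *: w = 0 -> x = 0) ->
    (forall x y, x *: v + y *: w = 0 -> x = 0) ->
    g2 * a1 = 1 -> b1 * a2 = 1 -> a != 0 -> b != 0 -> c != 0 ->
    Z u = a1 *: u + a *: w -> Z v = a2 *: v - a *: w ->
    X v = b1 *: v + b *: u -> X w = b2 *: w - b *: u ->
    Y w = g1 *: w + c *: v -> Y (k *: u) = g2 *: (k *: u) - c *: v ->
  k = q ^- 2.
Proof.
move=> YZ ZX uw vw ga ba a0 b0 c0 Zu Zv Xv Xw Yw Yu.
have aE : a = q ^+ 2 * a1 - a2.
  have /uw/eqP : (b * (q * a1 - q^-1 * (a2 + a))) *: u +
      (a * (q * (b - b1) + q^-1 * b2)) *: w = 0.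
    transitivity (q *: Z (X v) - q^-1 *: X (Z v) - ((q - q^-1) * (b1 * a2)) *: v).
      by rewrite Xv Zv !(lfunD, lfunN, lfunZ) Xv Xw Zu Zv; vector_ring.
    by rewrite ZX ba mulr1 subrr.
  rewrite mulf_eq0 (negPf b0) subr_eq0 => /eqP /(congr1 ( *%R q)).
  by rewrite mulVKf // mulrA -expr2 => ->; rewrite [a2 + a]addrC addrK.
have ka : k * a = a1 - q ^- 2 * a2.
  have /vw/eqP : (c * (q * (k * a - a1) + q^-1 * a2)) *: v +
      (k * a * (q * g1 - q^-1 * g2) - q^-1 * a * c) *: w = 0.
    transitivity (q *: Y (Z (k *: u)) - q^-1 *: Z (Y (k *: u)) -
        ((q - q^-1) * (g2 * a1)) *: (k *: u)).
      rewrite Yu !(lfunD, lfunN, lfunZ) Zu Zv.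
      have -> : Y (a1 *: u + a *: w) = a1 *: Y u + a *: Y w by rewrite lfunD !lfunZ.
      have -> : k *: (a1 *: Y u + a *: Y w) = a1 *: Y (k *: u) + (k * a) *: Y w.
        by rewrite lfunZ; vector_ring.
      by rewrite Yu Yw; vector_ring.
    by rewrite YZ ga mulr1 subrr.
  rewrite mulf_eq0 (negPf c0) => /eqP E.
  transitivity ((q * (k * a - a1) + q^-1 * a2) / q + (a1 - q ^- 2 * a2)).
    by field.
  by rewrite E mul0r add0r.
have : (k - q ^- 2) * a = 0 by rewrite mulrBl ka {1}aE; field.
by move/eqP; rewrite mulf_eq0 (negPf a0) orbF subr_eq0 => /eqP.
Qed.

Section WhiteClique.
Variables (N : nat) (theta : F) (X Y Z : 'End(V)).
Hypotheses (YZ : qcommute Y Z) (ZX : qcommute Z X).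
Hypothesis theta2 : theta ^+ 2 * (q ^+ 2) ^+ N = 1.
Local Notation nx := (nu Y Z).
Local Notation ny := (nu Z X).
Local Notation nz := (nu X Y).
Hypotheses (Tz : flag_action N theta nx ny nz Z) (Tx : flag_action N theta ny nz nx X)
  (Ty : flag_action N theta nz nx ny Y).
Local Notation inB r s t u :=
  [/\ u \in power_image nx r, u \in power_image ny s & u \in power_image nz t].

(** The three black 3-cliques that meet the white one along an edge are handled by
Z, X, Y respectively, after rotating the coordinates. *)
Lemma white_clique_ratio r s t u v w k : (r + s + t).+2 = N ->
    u != 0 -> v != 0 -> w != 0 ->
    inB r s.+1 t.+1 u -> inB r.+1 s t.+1 v -> inB r.+1 s.+1 t w ->
    (forall u', inB r s.+1 t.+1 u' -> exists a, u' = a *: u) ->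
    (forall v', inB r.+1 s t.+1 v' -> exists a, v' = a *: v) ->
    (forall w', inB r.+1 s.+1 t w' -> exists a, w' = a *: w) ->
    u + v \in power_image nz t.+2 -> v + w \in power_image nx r.+2 ->
    w + k *: u \in power_image ny s.+2 ->
  k = q ^- 2.
Proof.
move=> rst u0 v0 w0 uS vS wS lu lv lw uv vw wu.
have [[ux uy uz] [vx vy vz] [wx wy wz]] := And3 uS vS wS.
have [d1S Zv] := flag_action_edge Tz rst uS vS uv.
have rot1 : (s + t + r).+2 = N by rewrite addnC addnA.
have [[d2y d2z d2x] Xw] := flag_action_edge Tx rot1 (And3 vy vz vx) (And3 wy wz wx) vw.
have rot2 : (t + r + s).+2 = N by rewrite -addnA addnC.
have ku : [/\ k *: u \in power_image nz t.+1, k *: u \in power_image nx r &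
  k *: u \in power_image ny s.+1] by split; exact: memvZ.
have [[d3z d3x d3y] Yu] := flag_action_edge Ty rot2 (And3 wz wx wy) ku wu.
have [a Ea] := lw _ d1S.
have [b Eb] := lu _ (And3 d2x d2y d2z).
have [c Ec] := lv _ (And3 d3x d3y d3z).
have ee i : (i <= N)%N -> theta * (q ^+ 2) ^+ i * (theta * (q ^+ 2) ^+ (N - i)) = 1.
  by move=> iN; rewrite mulrACA -expr2 -exprD subnKC.
have nz0 (f g h A : 'End(V)) (l x : F) (p p' : V) (n : nat) :
    flag_action N theta f g h A -> p != 0 -> p \in power_image h n.+1 ->
    A p - l *: p = x *: p' -> x != 0.
  move=> T p0 ph E; apply: contraNneq p0 => x0; apply/eqP.
  apply: (action_no_eigenvector T (a := l)); last first.
    exact: subvP (power_image_le h _) _ ph.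
  by apply/eqP; rewrite -subr_eq0 E x0 scale0r.
have indep r1 s1 t1 r2 s2 t2 (p p' : V) x y : p != 0 ->
    (N < maxn r1 r2 + maxn s1 s2 + maxn t1 t2)%N ->
    inB r1 s1 t1 p -> inB r2 s2 t2 p' -> x *: p + y *: p' = 0 -> x = 0.
  move=> p0 gtN [px py pz] [px' py' pz'] /eqP; rewrite addr_eq0 -scaleNr => /eqP E.
  suff /eqP : x *: p = 0 by rewrite scaler_eq0 (negPf p0) orbF => /eqP.
  apply: (flag_action_opposite Tz gtN); split.
  - by rewrite /maxn; case: ifP => _; [rewrite E|]; apply: memvZ.
  - by rewrite /maxn; case: ifP => _; [rewrite E|]; apply: memvZ.
  - by rewrite /maxn; case: ifP => _; [rewrite E|]; apply: memvZ.
rewrite Ea in Zv; rewrite Eb in Xw; rewrite Ec in Yu.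
apply: (@white_clique_scalar X Y Z u v w k _ _ _ _
  (theta * (q ^+ 2) ^+ t) _ a b c YZ ZX _ _ _ _ _ _ _ _ Zv _ Xw _ Yu).
- by move=> x y; apply: indep u0 _ uS wS; clear -rst; lia.
- by move=> x y; apply: indep v0 _ vS wS; clear -rst; lia.
- rewrite mulrC; apply: ee; clear -rst; lia.
- apply: ee; clear -rst; lia.
- exact: nz0 Tz u0 uz Ea.
- exact: nz0 Tx v0 vx Eb.
- exact: nz0 Ty w0 wy Ec.
- by rewrite -Ea addrC subrK.
- by rewrite -Eb addrC subrK.
- by rewrite -Ec addrC subrK.
Qed.

End WhiteClique.

(** Each ladder provides the injectivity of the operator on which the next one is
built. *)
Lemma equitable_flag_actions N X Y Z : \dim {:V} = N.+1 -> irreducible_triple X Y Z ->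
    qcommute X Y -> qcommute Y Z -> qcommute Z X -> (forall u, Y u = 0 -> u = 0) ->
  exists theta, [/\ theta ^+ 2 * (q ^+ 2) ^+ N = 1,
    flag_action N theta (nu Y Z) (nu Z X) (nu X Y) Z,
    flag_action N theta (nu Z X) (nu X Y) (nu Y Z) X,
    flag_action N theta (nu X Y) (nu Y Z) (nu Z X) Y &
    forall t, [/\ \dim (power_image (nu Y Z) t) = (N.+1 - t)%N,
      \dim (power_image (nu Z X) t) = (N.+1 - t)%N &
      \dim (power_image (nu X Y) t) = (N.+1 - t)%N]].
Proof.
move=> dimV irr XY YZ ZX injY.
have irr' := irreducible_triple_rot irr; have irr'' := irreducible_triple_rot irr'.
have [theta1 L1] := ladder_exists dimV irr XY YZ ZX injY.
have [theta2 L2] := ladder_exists dimV irr' YZ ZX XY (ladder_injective L1).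
have [theta3 L3] := ladder_exists dimV irr'' ZX XY YZ (ladder_injective L2).
have [E2 Tz] := flag_action_of_ladders L1 L2.
have [E3 Tx] := flag_action_of_ladders L2 L3.
have [_ Ty] := flag_action_of_ladders L3 L1.
rewrite E3 E2 in Ty; rewrite E2 in Tx; exists theta1; split=> //.
  exact: ladder_theta L1.
move=> t; split.
- exact: (ladder_dim L2 t).
- exact: (ladder_dim L3 t).
- exact: (ladder_dim L1 t).
Qed.

End Operators.

(** * The module *)

Section Action.
Variables (F : fieldType) (q : F) (V : vectType F) (rho : uq_module q V).
Implicit Types (W : {vspace V}) (u : V).

Lemma actM a b u : rho (a * b) u = rho a (rho b u).
Proof. by rewrite uq_actM comp_lfunE. Qed.

Lemma act1 u : rho 1 u = u.
Proof. by rewrite uq_act1 id_lfunE. Qed.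

Lemma act_qcommute (a b : Uq q) : q - q^-1 != 0 ->
  (q - q^-1)^-1 *: (q *: (a * b) - q^-1 *: (b * a)) = 1 ->
  qcommute q (rho a) (rho b).
Proof.
move=> q0 /(congr1 (fun c => rho c)) ab u; rewrite -[u in RHS]act1 -ab.
have -> : rho ((q - q^-1)^-1 *: (q *: (a * b) - q^-1 *: (b * a))) =
    (q - q^-1)^-1 *: (q *: rho (a * b) - q^-1 *: rho (b * a)).
  by rewrite linearZ linearB !linearZ.
rewrite scale_lfunE scalerA mulfV // scale1r.
by rewrite add_lfunE opp_lfunE !scale_lfunE !actM.
Qed.

Lemma act_nu (a b : Uq q) : rho (q *: (1 - a * b)) = nu q (rho a) (rho b).
Proof. by rewrite linearZ linearB /= uq_act1 uq_actM. Qed.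

Lemma act_power_images (a : Uq q) N i :
  power_images rho a N i = power_image (rho a) (N - i).
Proof.
rewrite /power_images /power_image; congr (_ @: _)%VS.
elim: (N - i)%N => [|k IH]; first by rewrite expr0 uq_act1.
by rewrite exprS uq_actM IH.
Qed.

(** A monomial is a word in the generators, and acts by composing their
actions. *)
Lemma generators_stable W (s : seq 'I_4) :
    (forall i, (rho (qa_pi (uq_relator q) (fgen F i)) @: W <= W)%VS) ->
  (rho (qa_pi (uq_relator q) (mkmalgU (FMonom s) 1)) @: W <= W)%VS.
Proof.
move=> Wgen; elim: s => [|i s IH].
  have -> : FMonom [::] = mone :> {fmonom 'I_4} by apply: val_inj; apply/esym/fm1.
  have -> : qa_pi (uq_relator q) (mkmalgU mone 1) = 1.
    by rewrite mpolyC1E; exact: rmorph1.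
  by rewrite uq_act1 lim1g.
have -> : mkmalgU (FMonom (i :: s)) 1 = fgen F i * mkmalgU (FMonom s) 1 :> freeAlg F.
  rewrite /fgen [RHS]fgmulUU mulr1; congr (mkmalgU _ _).
  by apply: val_inj; rewrite [RHS]fmM fmU.
rewrite rmorphM uq_actM limg_comp; exact: subv_trans (limgS _ IH) (Wgen i).
Qed.

Lemma stable_submodule W :
    (forall i, (rho (qa_pi (uq_relator q) (fgen F i)) @: W <= W)%VS) ->
  uq_submodule rho W.
Proof.
move=> Wgen a; have [g ->] := qa_piP a.
rewrite [g]monalgE; apply/subvP => _ /memv_imgP[w wW ->].
rewrite linear_sum linear_sum sum_lfunE; apply: memv_suml => k _.
have -> : mkmalgU k g@_k = g@_k *: mkmalgU k 1 :> freeAlg F.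
  by rewrite -mul_malgC [RHS]fgmulUU mul1m mulr1.
have Wk : (rho (qa_pi (uq_relator q) (mkmalgU k 1)) @: W <= W)%VS.
  by have := generators_stable (fmonom_val k) Wgen; rewrite fmK.
rewrite !linearZ scale_lfunE memvZ //.
exact: subvP Wk _ (memv_img _ wW).
Qed.

Lemma Y_injective u : rho (uqy q) u = 0 -> u = 0.
Proof. by move=> yu; rewrite -[u]act1 -(uq_yVy q) actM yu linear0. Qed.

(** As V has finite dimension, the injective operator Y maps a stable subspace onto
itself. *)
Lemma yV_stable W : (rho (uqy q) @: W <= W)%VS -> (rho (uqyV q) @: W <= W)%VS.
Proof.
move=> yW; have kerW : (W :&: lker (rho (uqy q)))%VS = 0%VS.
  apply/eqP; rewrite -subv0; apply/subvP => u.
  by rewrite memv_cap memv_ker memv0 => /andP[_ /eqP/Y_injective ->].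
have : (rho (uqy q) @: W == W)%VS by rewrite eqEdim yW limg_dim_eq ?leqnn.
move/eqP => {1}<-; rewrite -limg_comp -uq_actM uq_yVy uq_act1.
by rewrite lim1g subvv.
Qed.

Lemma irreducible_action : uq_irreducible rho ->
  irreducible_triple (rho (uqx q)) (rho (uqy q)) (rho (uqz q)).
Proof.
move=> [_ irr] W Wx Wy Wz; apply: irr; apply: stable_submodule.
case=> -[|[|[|[|//]]]] i4; rewrite (bool_irrelevance i4 isT).
- exact: Wx.
- exact: Wy.
- exact: yV_stable.
- exact: Wz.
Qed.
End Action.

(** * Cliques *)

Section Cliques.
Variables (F : fieldType) (V : vectType F) (N : nat).
Hypothesis dimV : \dim {:V} = N.+1.
Implicit Types l m n : Delta N.

(** In each coordinate a black 3-clique takes some value twice and its successor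
once; this is the value at the third location given those at the other two. *)
Definition third_coord a b := if a == b then a.+1 else minn a b.

Lemma third_coordE a :
  ((third_coord a a = a.+1) * (third_coord a.+1 a = a) * (third_coord a a.+1 = a))%type.
Proof. by rewrite /third_coord eqxx; do !split; case: eqP => [|_]; lia. Qed.

Lemma black_clique_third l m n (l1 l2 l3 m1 m2 m3 : nat) :
    black_clique [set l; m; n] ->
    location_val l = (l1, l2, l3) -> location_val m = (m1, m2, m3) ->
  location_val n = (third_coord l1 m1, third_coord l2 m2, third_coord l3 m3).
Proof.
move=> bC El Em; have [r [s [t [_ EC]]]] := bC.
have : uniq [:: l; m; n].
  have := card_black_clique dimV bC; rewrite setUC cardsU1 cards2 !inE negb_or /=.
  rewrite ![n == _]eq_sym !inE negb_or.
  by case: (l == m) (l == n) (m == n) => [] [] [].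
have inC x : x \in [set l; m; n] ->
  location_val x \in [:: (r.+1, s, t); (r, s.+1, t); (r, s, t.+1)].
  by rewrite EC inE.
have /inC : l \in [set l; m; n] by rewrite !inE eqxx.
have /inC : m \in [set l; m; n] by rewrite !inE eqxx orbT.
have /inC : n \in [set l; m; n] by rewrite !inE eqxx !orbT.
rewrite -(map_inj_uniq (@location_inj N)) /= El Em.
case: (location_val n) => [[n1 n2] n3]; rewrite !inE.
by do 3!(case/or3P => /eqP[-> -> ->]); rewrite ?eqxx ?orbT ?andbF // !third_coordE.
Qed.

Lemma black_clique_of l m n a b c :
    location_val l = a -> location_val m = b -> location_val n = c ->
    (exists r s t, (r + s + t).+1 = N /\
      [:: a; b; c] =i [:: (r.+1, s, t); (r, s.+1, t); (r, s, t.+1)]) ->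
  black_clique [set l; m; n].
Proof.
move=> <- <- <- [r [s [t [E P]]]]; exists r, s, t; split=> //.
apply/setP => x; rewrite [RHS]inE -P !inE.
by rewrite !(inj_eq (@location_inj N)) orbA.
Qed.
End Cliques.

(** * The maps between adjacent lines *)

Section Btilde.
Variables (F : fieldType) (V : vectType F) (N : nat) (B : Delta N -> {vspace V}).
Hypothesis dimV : \dim {:V} = N.+1.
Implicit Types l m n k : Delta N.

(** On a line the map is determined by the image v of a single nonzero vector
u. *)
Lemma is_btilde_exists l m k u v : \dim (B l) = 1%N ->
    black_clique [set l; m; k] -> u != 0 -> v != 0 ->
    u \in B l -> v \in B m -> u + v \in B k ->
  exists f, @is_btilde F V N B l m f.
Proof.
move=> dimB bC u0 v0 ul vm uvk.
pose g (x : subvs_of (B l)) : subvs_of (B m) :=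
  coord [tuple u] ord0 (vsval x) *: vsproj (B m) v.
have gl : linear g.
  by move=> a x y; rewrite /g !linearP /= scalerDl scalerA.
pose gM := GRing.isLinear.Build _ _ _ _ g gl.
pose gL : {linear _ -> _} := HB.pack g gM.
exists (linfun gL) => x x0.
have [a xa] := line_scalar dimB u0 ul (subvsP x).
have a0 : a != 0.
  by apply: contraNneq x0 => a0; apply/eqP/subvs_inj; rewrite xa a0 scale0r linear0.
have -> : linfun gL x = a *: vsproj (B m) v.
  rewrite lfunE /= /g; congr (_ *: _); rewrite xa linearZ /=.
  rewrite -[u in X in _ * X]/([tuple u]`_(@ord0 0)) coord_free ?mulr1 //.
  by rewrite seq1_free.
split; last by exists k => //; rewrite linearZ /= vsprojK // xa -scalerDr memvZ.
rewrite scaler_eq0 (negPf a0); apply: contraNneq v0 => /(congr1 vsval) /eqP.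
by rewrite vsprojK // linear0.
Qed.

(** The third location of the black 3-clique in the definition of the map is
determined by l and m, so that it is k. *)
Lemma btilde_clique l m k u v : \dim (B l) = 1%N ->
    black_clique [set l; m; k] -> u != 0 -> v != 0 ->
    u \in B l -> v \in B m -> u + v \in B k ->
  forall x, x != 0 -> btilde B l m x != 0 /\
    vsval x + vsval (btilde B l m x) \in B k.
Proof.
move=> dimB bC u0 v0 ul vm uvk x x0.
have /(classical_sets.xgetPex 0) Tx := is_btilde_exists dimB bC u0 v0 ul vm uvk.
have [Tx0 [n bn xn]] := Tx x x0; split=> //.
suff -> : k = n by [].
apply: location_inj; move: (erefl (location_val l)) (erefl (location_val m)).
case: {-1}(location_val l) {-1}(location_val m) => [[l1 l2] l3] [[m1 m2] m3] El Em.
by rewrite (black_clique_third dimV bC El Em) (black_clique_third dimV bn El Em).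
Qed.

Lemma clique_value_eq l m n c : \dim (B l) = 1%N ->
    (forall u, btilde B n l (btilde B m n (btilde B l m u)) = c *: u) ->
  clique_value B l m n = c.
Proof.
move=> dimB Tc; apply: classical_sets.xget_unique => // d Td.
have : B l != 0%VS by rewrite -dimv_eq0 dimB.
rewrite -vpick0 => u0; have /eqP := Td (vsproj (B l) (vpick (B l))).
rewrite Tc -subr_eq0 -scalerBl scaler_eq0 subr_eq0 => /orP[/eqP //|].
move=> /eqP/(congr1 vsval); rewrite vsprojK ?memv_pick // linear0 => /eqP.
by rewrite (negPf u0).
Qed.
End Btilde.

(** * The value of a white clique *)

Section Main.
Variables (F : fieldType) (q : F).
Hypothesis q_neq0 : q != 0.
Variables (N : nat) (V : vectType F) (theta : F) (X Y Z : 'End(V)).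
Hypothesis dimV : \dim {:V} = N.+1.
Hypotheses (YZ : qcommute q Y Z) (ZX : qcommute q Z X).
Hypothesis theta2 : theta ^+ 2 * (q ^+ 2) ^+ N = 1.
Local Notation nx := (nu q Y Z).
Local Notation ny := (nu q Z X).
Local Notation nz := (nu q X Y).
Hypotheses (Tz : flag_action q N theta nx ny nz Z)
  (Tx : flag_action q N theta ny nz nx X) (Ty : flag_action q N theta nz nx ny Y).
Variable B : Delta N -> {vspace V}.
Hypothesis B_def : forall l r s t, location_val l = (r, s, t) ->
  B l = (power_image nx r :&: power_image ny s :&: power_image nz t)%VS.
Hypothesis dimB : forall l, \dim (B l) = 1%N.

Lemma mem_B l r s t u : location_val l = (r, s, t) ->
  u \in B l <-> [/\ u \in power_image nx r, u \in power_image ny s &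
    u \in power_image nz t].
Proof.
move=> El; rewrite (B_def El) !memv_cap -andbA.
by split=> [/and3P[]|[-> -> ->]].
Qed.

Lemma white_clique_value l m n : white_clique l m n -> clique_value B l m n = q ^- 2.
Proof.
move=> [r [s [t [rst [El Em En]]]]].
have [kz Ekz] : exists k : Delta N, location_val k = (r, s, t.+2).
  by apply: (location_ex dimV); rewrite -rst !addnS.
have [kx Ekx] : exists k : Delta N, location_val k = (r.+2, s, t).
  by apply: (location_ex dimV); rewrite -rst.
have [ky Eky] : exists k : Delta N, location_val k = (r, s.+2, t).
  by apply: (location_ex dimV); rewrite -rst !addnS !addSn.
have bz : black_clique [set l; m; kz].
  apply: (black_clique_of El Em Ekz); exists r, s, t.+1.
  split; first by rewrite -rst addnS.
  by move=> x; rewrite !inE; do 3!case: (x == _).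
have bx : black_clique [set m; n; kx].
  apply: (black_clique_of Em En Ekx); exists r.+1, s, t; split; first by rewrite -rst.
  by move=> x; rewrite !inE; do 3!case: (x == _).
have bky : black_clique [set n; l; ky].
  apply: (black_clique_of En El Eky); exists r, s.+1, t.
  split; first by rewrite -rst addnS.
  by move=> x; rewrite !inE; do 3!case: (x == _).
have nonzero k : exists2 p, p != 0 & p \in B k.
  exists (vpick (B k)); last exact: memv_pick.
  by rewrite vpick0 -dimv_eq0 dimB.
have [pz pz0 /(mem_B _ Ekz) pzB] := nonzero kz.
have [px px0 /(mem_B _ Ekx) [px1 px2 px3]] := nonzero kx.
have [py py0 /(mem_B _ Eky) [py1 py2 py3]] := nonzero ky.
have rstx : (s + t + r).+2 = N by rewrite addnC addnA.
have rsty : (t + r + s).+2 = N by rewrite -addnA addnC.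
have [uz [vz [uz0 vz0 uzS vzS uvz]]] := flag_action_split q_neq0 Tz rst pz0 pzB.
have [ux [vx [ux0 vx0 [ux1 ux2 ux3] [vx1 vx2 vx3] uvx]]] :=
  flag_action_split q_neq0 Tx rstx px0 (And3 px2 px3 px1).
have [uy [vy [uy0 vy0 [uy1 uy2 uy3] [vy1 vy2 vy3] uvy]]] :=
  flag_action_split q_neq0 Ty rsty py0 (And3 py3 py1 py2).
have leS f i p : p \in power_image f i.+1 -> p \in power_image f i.
  exact: (subvP (power_imageS f i)).
have Tlm : forall x : subvs_of (B l), x != 0 -> btilde B l m x != 0 /\
    vsval x + vsval (btilde B l m x) \in B kz.
  apply: (btilde_clique dimV (dimB l) bz uz0 vz0); first exact/(mem_B _ El).
    exact/(mem_B _ Em).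
  case: uzS vzS => uz1 uz2 uz3 [vz1 vz2 vz3]; apply/(mem_B _ Ekz).
  by split=> //; apply: memvD => //; apply: leS.
have Tmn : forall x : subvs_of (B m), x != 0 -> btilde B m n x != 0 /\
    vsval x + vsval (btilde B m n x) \in B kx.
  apply: (btilde_clique dimV (dimB m) bx ux0 vx0); first exact/(mem_B _ Em).
    exact/(mem_B _ En).
  apply/(mem_B _ Ekx).
  by split=> //; apply: memvD => //; apply: leS.
have Tnl : forall x : subvs_of (B n), x != 0 -> btilde B n l x != 0 /\
    vsval x + vsval (btilde B n l x) \in B ky.
  apply: (btilde_clique dimV (dimB n) bky uy0 vy0); first exact/(mem_B _ En).
    exact/(mem_B _ El).
  apply/(mem_B _ Eky).
  by split=> //; apply: memvD => //; apply: leS.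
apply: clique_value_eq => // u; have [->|u0] := eqVneq u 0.
  by rewrite !linear0.
have [v0 /(mem_B _ Ekz) [_ _ uv]] := Tlm u u0; move: v0 uv.
move: (btilde B l m u) => v v0 uv.
have [w0 /(mem_B _ Ekx) [vw _ _]] := Tmn v v0; move: w0 vw.
move: (btilde B m n v) => w w0 vw.
have [_ /(mem_B _ Eky) [_ wu _]] := Tnl w w0; move: wu.
move: (btilde B n l w) => u' wu.
have val_neq0 k (x : subvs_of (B k)) : x != 0 -> vsval x != 0.
  by apply: contraNneq => x0; apply/eqP/subvs_inj; rewrite x0 linear0.
have span1 k (x : subvs_of (B k)) p : x != 0 -> p \in B k -> exists a, p = a *: vsval x.
  by move=> /val_neq0 x0; apply: (line_scalar (dimB k) x0); apply: subvsP.
have [a u'E] := span1 l u (vsval u') u0 (subvsP u').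
suff <- : a = q ^- 2 by apply: subvs_inj; rewrite u'E linearZ.
rewrite u'E in wu.
apply: (white_clique_ratio q_neq0 YZ ZX theta2 Tz Tx Ty rst (val_neq0 _ _ u0)
  (val_neq0 _ _ v0) (val_neq0 _ _ w0) _ _ _ _ _ _ uv vw wu).
- by apply/(mem_B _ El); apply: subvsP.
- by apply/(mem_B _ Em); apply: subvsP.
- by apply/(mem_B _ En); apply: subvsP.
- by move=> p /(mem_B _ El); apply: span1.
- by move=> p /(mem_B _ Em); apply: span1.
- by move=> p /(mem_B _ En); apply: span1.
Qed.
End Main.

Theorem corollary21p31 (F : fieldType) (q : F)
    (q_neq0 : q != 0)
    (q_not_root_of_unity : forall k : nat, (0 < k)%N -> q ^+ k != 1)
    (N : nat) (V : vectType F) (rho : uq_module q V)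
    (rho_irr : uq_irreducible rho) (dimV : \dim {:V} = N.+1) :
  let Ux := power_images rho (nu_x q) N in
  let Uy := power_images rho (nu_y q) N in
  let Uz := power_images rho (nu_z q) N in
  let B := flag_array (N := N) Ux Uy Uz in
  [/\ flag N Ux, flag N Uy, flag N Uz & totally_opposite N Ux Uy Uz] /\
  (billiard_array B /\
   forall l m n : Delta N, white_clique l m n ->
     clique_value B l m n = q ^- 2).
Proof.
move=> Ux Uy Uz B.
have q2 : q - q^-1 != 0.
  apply: contraNneq (q_not_root_of_unity 2%N isT) => /eqP.
  by rewrite subr_eq0 => /eqP qV; rewrite expr2 {1}qV mulVf.
have XY := act_qcommute rho q2 (uq_xy q).
have YZ := act_qcommute rho q2 (uq_yz q).
have ZX := act_qcommute rho q2 (uq_zx q).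
have [theta [theta2 Tz Tx Ty dims]] := equitable_flag_actions q_neq0 q_not_root_of_unity
  dimV (irreducible_action rho_irr) XY YZ ZX (@Y_injective _ _ _ rho).
have UxE : Ux = fun i => power_image (nu q (rho (uqy q)) (rho (uqz q))) (N - i).
  by apply: funext => i; rewrite /Ux act_power_images act_nu.
have UyE : Uy = fun i => power_image (nu q (rho (uqz q)) (rho (uqx q))) (N - i).
  by apply: funext => i; rewrite /Uy act_power_images act_nu.
have UzE : Uz = fun i => power_image (nu q (rho (uqx q)) (rho (uqy q))) (N - i).
  by apply: funext => i; rewrite /Uz act_power_images act_nu.
have flx : flag N Ux by rewrite UxE; apply: power_image_flag => t; case: (dims t).
have fly : flag N Uy by rewrite UyE; apply: power_image_flag => t; case: (dims t).
have flz : flag N Uz by rewrite UzE; apply: power_image_flag => t; case: (dims t).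
have opp : totally_opposite N Ux Uy Uz.
  move=> r s t rN sN tN rst; apply/eqP; rewrite -subv0 UxE UyE UzE !subKn //.
  apply/subvP => u; rewrite !memv_cap memv0 => /andP[/andP[ux uy] uz].
  by apply/eqP; apply: (flag_action_opposite Tz rst).
have bil : billiard_array B by apply: flag_array_billiard.
split; [by [] | split; first by []].
have [dimB _ _] := bil; move=> l m n.
apply: (white_clique_value q_neq0 dimV YZ ZX theta2 Tz Tx Ty _ dimB).
move=> k r s t Ek; rewrite /B /flag_array Ek UxE UyE UzE.
have rst : (r + s + t)%N = N.
  by move: (location_sum k); case: (location_val k) Ek => [[r' s'] t'] [-> -> ->].
by rewrite !subKn //; lia.
Qed.
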